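(* Let $D=V(f)\subset \mathbb{P}^n$ be a reduced complex projective hypersurface defined by a homogeneous polynomial $f\in R=\mathbb{C}[x_0,\dots,x_n]$ of degree $d$, and let $p\in D$. Then $D$ is strongly Euler homogeneous at $p$ if and only if $$\operatorname{rk} M'_f(p)=\operatorname{rk} M_f(p),$$ where $\operatorname{rk} M'_f(p)$ and $\operatorname{rk} M_f(p)$ are the syzygy rank and the augmented syzygy rank of $f$ at $p$.
   Context: Strong Euler homogeneity: a holomorphic function germ $g:(\mathbb{C}^n,0)\to(\mathbb{C},0)$ is strongly Euler homogeneous if in some holomorphic local coordinates $x_1,\dots,x_n$ of $(\mathbb{C}^n,0)$ one has $g=\sum_{i=1}^n a_i\,\partial g/\partial x_i$ with every $a_i$ in the maximal ideal $\mathfrak{m}_{\mathbb{C}^n,0}$. A reduced hypersurface $D$ in a complex manifold is strongly Euler homogeneous at $p\in D$ if $D$ is defined near $p$ by a strongly Euler homogeneous germ (in coordinates centered at $p$). Syzygy matrices: $R$ has the standard grading and $f_{x_i}=\partial f/\partial x_i$. The global Jacobian ideal is $J_f=(f_{x_0},\dots,f_{x_n})$. Choose a free presentation of graded modules $$\bigoplus_{i=1}^m R(-d_i)\xrightarrow{\,M'_f\,}R^{n+1}\to J_f(d-1)\to 0,$$ where the $i$-th generator of $R^{n+1}$ is sent to $f_{x_i}$. Thus $M'_f$ is an $(n+1)\times m$ matrix whose columns $(\delta_{k,0},\dots,\delta_{k,n})^T$, $k=1,\dots,m$, with entries homogeneous of degree $d_k$, generate the $R$-module of relations $\sum_i\delta_{k,i}f_{x_i}=0$.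 Since $\sum_i x_if_{x_i}=d f$, one has $f\in J_f$, and $M_f$ denotes the $(n+1)\times(m+1)$ matrix obtained from $M'_f$ by adding the column $(x_0,\dots,x_n)^T$; it presents $(J_f/(f))(d-1)$. For $p=[p_0:\dots:p_n]\in D$, $\operatorname{rk} M'_f(p)$ and $\operatorname{rk} M_f(p)$ are the ranks of the scalar matrices obtained by evaluating at $(\lambda p_0,\dots,\lambda p_n)$ for any $\lambda\in\mathbb{C}^*$ (the ranks do not depend on $\lambda$). They are called the syzygy rank and the augmented syzygy rank of $f$ at $p$. *)

(* Defs.v *)
From mathcomp Require Import all_boot all_order all_algebra.
From mathcomp Require Import -(notations) mpoly.
From mathcomp Require Import all_classical all_reals.
From mathcomp Require Import topology normedtype derive.

Set Implicit Arguments.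
Unset Strict Implicit.
Unset Printing Implicit Defensive.

Import Order.TTheory GRing.Theory Num.Theory numFieldNormedType.Exports.
Local Open Scope classical_set_scope.
Local Open Scope ring_scope.

(* The notations of mpoly clash with those of the analysis library; these are
   the few that are needed. *)
Notation "{ 'mpoly' T [ n ] }" := (mpoly n T)
  (at level 0, T, n at level 2, format "{ 'mpoly'  T [ n ] }").
Notation mvar k := (mpolyX _ (mnm1 k)).
Notation "d '.-homog'" := (ishomog1 d mdeg)
  (at level 1, format "d .-homog") : form_scope.

(* The definitions make sense over any numeric field C, with the topology given
   by its norm; C is meant to be the field R[i] of complex numbers. *)

Section HolomorphicGerms.
Variables (C : numFieldType) (n : nat).
Implicit Types (g : 'rV[C]_n -> C) (phi psi : 'rV[C]_n -> 'rV[C]_n).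

(* The germs at 0 of functions and maps are given by representatives defined
   on the whole of C^n, whose values matter only near 0. *)

Definition monomial (m : multinom n) (z : 'rV[C]_n) : C :=
  \prod_(i < n) z 0 i ^+ m i.

(* Weierstrass' definition: on a neighbourhood of a, g is the sum of an
   absolutely convergent power series in the coordinates centered at a.
   The N-th partial sum is over the multi-indices of total degree < N. *)
Definition holomorphic_at g (a : 'rV[C]_n) : Prop :=
  exists c : multinom n -> C, \forall z \near a,
    (exists M : C, forall N : nat,
       \sum_(m : bmultinom n N) `|c m * monomial m (z - a)| <= M) /\
    (\sum_(m : bmultinom n N) c m * monomial m (z - a))
      @[N --> \oo] --> g z.

Definition holomorphic_germ g : Prop :=
  \forall a \near (0 : 'rV[C]_n), holomorphic_at g a.

Definition holomorphic_map_germ phi : Prop :=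
  forall j : 'I_n, holomorphic_germ (fun z => phi z 0 j).

Definition in_maximal_ideal g : Prop := holomorphic_germ g /\ g 0 = 0.

Definition unit_germ g : Prop := holomorphic_germ g /\ g 0 != 0.

(* Holomorphic local coordinates phi = (x_1, ..., x_n) of (C^n, 0), with psi
   the inverse germ. *)
Definition local_coordinates phi psi : Prop :=
  [/\ holomorphic_map_germ phi /\ phi 0 = 0,
      holomorphic_map_germ psi /\ psi 0 = 0,
      (\forall z \near (0 : 'rV[C]_n), psi (phi z) = z) &
      (\forall z \near (0 : 'rV[C]_n), phi (psi z) = z)].

(* dg/dx_k for the coordinates phi with inverse psi. *)
Definition coordinate_partial phi psi g (k : 'I_n) : 'rV[C]_n -> C :=
  fun z => 'D_(delta_mx 0 k) (g \o psi) (phi z).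

Definition strongly_Euler_homogeneous_germ g : Prop :=
  in_maximal_ideal g /\
  exists phi psi, local_coordinates phi psi /\
  exists a : 'I_n -> 'rV[C]_n -> C,
    (forall k, in_maximal_ideal (a k)) /\
    \forall z \near (0 : 'rV[C]_n),
      g z = \sum_(k < n) a k z * coordinate_partial phi psi g k z.

End HolomorphicGerms.

Section Hypersurface.
Variables (C : numFieldType) (n : nat).
Implicit Types (f : {mpoly C[n.+1]}) (p : 'rV[C]_n.+1).

Definition mpoly_eval f p : C := meval (fun j => p 0 j) f.

(* R/(f) is a reduced ring and f is not 0. *)
Definition reduced_equation f : Prop :=
  f != 0 /\
  forall (h : {mpoly C[n.+1]}) (k : nat),
    (exists q, h ^+ k = q * f) -> exists q, h = q * f.

(* The standard chart C^n -> { x_i != 0 } of P^n, in homogeneous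
   coordinates: insert a 1 at position i. *)
Definition affine_chart (i : 'I_n.+1) (z : 'rV[C]_n) : 'rV[C]_n.+1 :=
  \row_j if unlift i j is Some k then z 0 k else 1.

Definition affine_coord (i : 'I_n.+1) p : 'rV[C]_n :=
  \row_k (p 0 (lift i k) / p 0 i).

(* g is the germ, in coordinates of P^n centered at p, of an equation of
   D = V(f): it generates the ideal of D at p, which is generated by the
   dehomogenization of f.  The coordinates are the composite of a standard
   chart around p, translated to the origin, with local coordinates of
   (C^n, 0) whose inverse is psi. *)
Definition defines_near f p (g : 'rV[C]_n -> C) : Prop :=
  exists i phi psi,
    [/\ p 0 i != 0, local_coordinates phi psi &
      exists u : 'rV[C]_n -> C, unit_germ u /\
        \forall z \near (0 : 'rV[C]_n),
          g z = u z * mpoly_eval f (affine_chart i (affine_coord i p + psi z))].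

Definition strongly_Euler_homogeneous_at f p : Prop :=
  exists g, strongly_Euler_homogeneous_germ g /\ defines_near f p g.

Definition is_relation f (v : 'cV[{mpoly C[n.+1]}]_n.+1) : Prop :=
  \sum_(i < n.+1) v i 0 * mderiv i f = 0.

(* The matrix M'_f of a graded free presentation of J_f(d-1): its k-th column
   is homogeneous of degree e k, and its columns generate the relations. *)
Definition syzygy_matrix f m (e : 'I_m -> nat)
    (M' : 'M[{mpoly C[n.+1]}]_(n.+1, m)) : Prop :=
  [/\ (forall i k, M' i k \is (e k).-homog),
      (forall k, is_relation f (col k M')) &
      (forall v, is_relation f v -> exists w : 'cV_m, v = M' *m w)].

Definition augmented_syzygy_matrix m (M' : 'M[{mpoly C[n.+1]}]_(n.+1, m)) :
    'M[{mpoly C[n.+1]}]_(n.+1, m + 1) :=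
  row_mx M' (\col_i mvar i).

Definition rank_at m (M : 'M[{mpoly C[n.+1]}]_(n.+1, m)) p : nat :=
  \rank (map_mx (fun h => mpoly_eval h p) M).

End Hypersurface.

(* Main.v *)
Require Import Defs.
From HB Require Import structures.
From mathcomp Require Import all_boot all_order all_algebra.
From mathcomp Require Import complex.
From mathcomp Require Import -(notations) mpoly.
From mathcomp Require Import all_classical all_reals.
From mathcomp Require Import interval_inference topology normedtype derive.
From mathcomp Require Import ring zify.

Set Implicit Arguments.
Unset Strict Implicit.
Unset Printing Implicit Defensive.

Import Order.TTheory GRing.Theory Num.Theory numFieldNormedType.Exports.
Local Open Scope ring_scope.
Local Open Scope complex_scope.

(** Both sides of the equivalence say that the equation of D at p lies in
the ideal m * J(F).  Let F be the dehomogenization of f in a standard chart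
around p, with affine coordinates y_1, ..., y_n centered at p.  The
intermediate condition, [algebraic_Euler F], asks for polynomials w, b_1,
..., b_n such that

  w F = b_1 dF/dy_1 + ... + b_n dF/dy_n,   w(0) <> 0,   b_j(0) = 0.

Syzygies.  Adding the column (x_0, ..., x_n) to M' leaves the rank at p
unchanged exactly when the vector p lies in the column space of M'(p), that
is, when some relation delta between the partial derivatives of f takes a
nonzero multiple of p as its value at p.  Euler's formula
deg(f) f = sum_j x_j df/dx_j eliminates the derivative df/dx_i from such a
relation, where x_i = 1 is the chart: it becomes an equation as above with
w = deg(f) delta_i and b_k = delta_i x_k - delta_k, and b_k vanishes at p
because delta(p) is proportional to p ([Euler_of_relation]).  Homogenizing w
and the b_k gives the converse ([relation_of_Euler]).

From algebra to analysis.  The quotients b_j / w are sums of convergent power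
series, obtained by expanding 1 / w as a geometric series
([rational_holomorphic_at]).  Hence F itself is a strongly Euler homogeneous
equation in the coordinates y.

From analysis to algebra.  A strongly Euler homogeneous equation g involves a
unit and two changes of coordinates, one in the definition of the property
and one in the choice of the equation.  Removing them by the product rule and
the chain rule leaves F in m * J(F) for the ring of convergent power series.
The computation is done with polynomials modulo m^N, for every N: [jet N h q]
says that h - q is Lipschitz on the ball of radius s with a constant that is
O(s^N).  Sums of power series have jets of every order
([holomorphic_at_jet]), jets are compatible with products and with
composition ([jetM], [jet_comp]), and, unlike mere O(s^(N+1)) estimates, they
control first derivatives ([jet_derive_bound]).  This yields F in m J(F) + m^N
for all N ([strongly_Euler_approx]).

Krull's intersection theorem ([krull_intersection]) then gives a polynomial w
with w(0) = 1 and w F in m J(F).  It is derived from Hilbert's basis theorem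
through the Rees algebra of m. *)

(** * Polynomials in several variables *)

Lemma mpoly_ring_ind (R : comNzRingType) n (P : {mpoly R[n]} -> Prop) :
  (forall c, P (mpolyC n c)) -> (forall i, P (mvar i)) ->
  (forall p q, P p -> P q -> P (p + q)) ->
  (forall p q, P p -> P q -> P (p * q)) ->
  forall p, P p.
Proof.
move=> PC PX PD PM; apply: mpolyind => [|c m p _ _ Pp].
  by rewrite -(mpolyC0 n R); apply: PC.
apply: PD => //; rewrite -mul_mpolyC; apply: (PM _ _) => //.
rewrite mpolyXE_id; apply: (big_ind P) => [|p1 p2 H1 H2|i _].
- by rewrite -(mpolyC1 n R); apply: PC.
- exact: PM.
elim: (m i) => [|k IH]; first by rewrite expr0 -(mpolyC1 n R); apply: PC.
by rewrite exprS; apply: (PM _ _) => //; exact: PX.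
Qed.

Lemma mderiv_var (R : nzRingType) n k i :
  mderiv k (mvar i) = (i == k)%:R :> {mpoly R[n]}.
Proof.
rewrite mderivX mnm1E; case: eqP => [->|_]; last by rewrite scale0r.
rewrite scale1r (_ : mnm_sub _ _ = @mnm0 n) ?mpolyX0 //.
by apply/mnmP => j; rewrite mnmBE mnm0E subnn.
Qed.

Lemma mpolyX_neq0 (R : nzRingType) n (m : multinom n) : mpolyX R m != 0.
Proof.
apply/eqP => /(congr1 (mcoeff m)); rewrite mcoeffX eqxx mcoeff0 => /eqP.
by rewrite oner_eq0.
Qed.

Lemma mcoeff_mnm0 (R : comNzRingType) n (p : {mpoly R[n]}) :
  mcoeff (@mnm0 n) p = meval (fun=> 0) p.
Proof.
elim/mpoly_ring_ind: p => [c|i|p q Hp Hq|p q Hp Hq].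
- by rewrite mcoeffC eqxx mulr1 mevalC.
- by rewrite mevalXU mcoeffX mnm1_eq0.
- by rewrite !rmorphD /= Hp Hq.
- by rewrite !rmorphM /= Hp Hq.
Qed.

Lemma meval_sum (R : nzRingType) k (v : 'I_k -> R) (I : Type) (r : seq I)
    (q : I -> {mpoly R[k]}) :
  meval v (\sum_(i <- r) q i) = \sum_(i <- r) meval v (q i).
Proof. exact: raddf_sum. Qed.

Lemma mderiv_comp (R : comNzRingType) n k (Q : n.-tuple {mpoly R[k]})
    (q : {mpoly R[n]}) l :
  mderiv l (comp_mpoly Q q) =
    \sum_j comp_mpoly Q (mderiv j q) * mderiv l (tnth Q j).
Proof.
elim/mpoly_ring_ind: q => [c|i|p q Hp Hq|p q Hp Hq].
- rewrite comp_mpolyC mderivC big1 // => j _.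
  by rewrite mderivC comp_mpoly0 mul0r.
- rewrite comp_mpolyXU -tnth_nth (bigD1 i) //= big1 ?addr0 => [|j ji].
    by rewrite mderiv_var eqxx comp_mpoly1 mul1r.
  by rewrite mderiv_var eq_sym (negPf ji) comp_mpoly0 mul0r.
- rewrite comp_mpolyD mderivD Hp Hq -big_split /=; apply: eq_bigr => j _.
  by rewrite mderivD comp_mpolyD mulrDl.
- rewrite rmorphM mderivM Hp Hq mulr_suml mulr_sumr -big_split /=.
  by apply: eq_bigr => j _; rewrite mderivM comp_mpolyD !rmorphM /=; ring.
Qed.

(** * Hilbert's basis theorem *)

(** Each next index is chosen so that [s] takes there its minimum over all
later indices. *)
Lemma subseq_nondecreasing (s : nat -> nat) :
  exists phi : nat -> nat, (forall i, phi i < phi i.+1)%N /\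
    forall i, (s (phi i) <= s (phi i.+1))%N.
Proof.
have minP N : exists m, (N <= m)%N /\ forall j, (N <= j)%N -> (s m <= s j)%N.
  suff H k : forall m, (N <= m)%N -> (s m <= k)%N ->
      exists m, (N <= m)%N /\ forall j, (N <= j)%N -> (s m <= s j)%N.
    by apply: (H (s N) N).
  elim: k => [|k IH] m Nm smk.
    by exists m; split=> // j _; apply: leq_trans smk _.
  have [[j [Nj sj]]|H] := pselect (exists j, (N <= j)%N /\ (s j <= k)%N).
    exact: IH Nj sj.
  exists m; split=> // j Nj; apply: leq_trans smk _.
  by rewrite ltnNge; apply/negP => sj; apply: H; exists j.
have [f fP] := choice minP.
pose fix phi i := if i is j.+1 then f (phi j).+1 else f 0%N.
exists phi; split=> i /=; first by case: (fP (phi i).+1).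
case: i => [|i] /=; first by apply: (fP 0%N).2.
by apply: (fP (phi i).+1).2; apply: leq_trans (ltnW (fP _.+1).1); apply: (fP _.+1).1.
Qed.

Lemma subseq_ltn (phi : nat -> nat) : (forall i, phi i < phi i.+1)%N ->
  forall i j, (i < j)%N -> (phi i < phi j)%N.
Proof. by move=> H i j; apply: (homo_ltn ltn_trans H). Qed.

(** Dickson's lemma: pass to a subsequence that is nondecreasing in one more
exponent at a time. *)
Lemma dickson k (s : nat -> multinom k) :
  exists i j, (i < j)%N /\ mpoly.lem (s i) (s j).
Proof.
suff [phi [phi_inc phiP]] : exists phi : nat -> nat,
    (forall i, phi i < phi i.+1)%N /\
    forall l, l \in enum 'I_k -> forall i, (s (phi i) l <= s (phi i.+1) l)%N.
  exists (phi 0%N), (phi 1%N); split; first exact: phi_inc.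
  by apply/mnm_lepP => l; apply: phiP; rewrite mem_enum.
elim: (enum 'I_k) => [|l r [phi [phi_inc IH]]]; first by exists id.
have [psi [psi_inc psiP]] := subseq_nondecreasing (fun i => s (phi i) l).
exists (phi \o psi); split=> [i|l'] /=; first exact: subseq_ltn.
rewrite inE => /orP[/eqP -> //|l'r] i.
apply: (homo_leq leqnn leq_trans (fun i => IH l' l'r i)).
exact/ltnW.
Qed.

Section HilbertBasis.
Variables (F : fieldType) (k : nat).
Implicit Types (P Q : nat -> {mpoly F[k]}).

Definition in_ideal_of P N (r : {mpoly F[k]}) : Prop :=
  exists Q, r = \sum_(i < N) Q i * P i.

(** Hilbert's basis theorem, in the form that is convenient for a sequence of
generators.  If no [P N] were a combination of the previous terms, one could
choose in each class of [P N] modulo the previous terms an element [r N]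
whose leading monomial is least.  By Dickson's lemma the leading monomial of
some [r i] divides that of a later [r j], and cancelling the leading term of
[r j] contradicts minimality. *)
Lemma hilbert_basis P : exists N, in_ideal_of P N (P N).
Proof.
apply: contrapT => /forallNP noP.
have I0 N : in_ideal_of P N 0.
  by exists (fun=> 0); rewrite big1 // => i _; rewrite mul0r.
have ID N r t : in_ideal_of P N r -> in_ideal_of P N t -> in_ideal_of P N (r + t).
  move=> [Q1 ->] [Q2 ->]; exists (fun i => Q1 i + Q2 i).
  by rewrite -big_split; apply: eq_bigr => i _; rewrite mulrDl.
have IM N r t : in_ideal_of P N r -> in_ideal_of P N (t * r).
  move=> [Q ->]; exists (fun i => t * Q i).
  by rewrite big_distrr /=; apply: eq_bigr => i _; rewrite mulrA.
have IW M N r : (M <= N)%N -> in_ideal_of P M r -> in_ideal_of P N r.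
  move=> MN [Q ->]; exists (fun i => if (i < M)%N then Q i else 0).
  rewrite (big_ord_widen_cond N xpredT (fun i => Q i * P i)) // big_mkcond /=.
  by apply: eq_bigr => i _; case: ifP => // _; rewrite mul0r.
have Iself N : in_ideal_of P N.+1 (P N).
  exists (fun i => (i == N)%:R); rewrite big_ord_recr /= eqxx mul1r big1 ?add0r //.
  by move=> i _; rewrite ltn_eqF // mul0r.
have minP N : exists r, in_ideal_of P N (r - P N) /\
    forall t, in_ideal_of P N (t - P N) -> ~~ (mlead t < mlead r)%O.
  suff H : forall m r, mlead r = m -> in_ideal_of P N (r - P N) ->
     exists r, in_ideal_of P N (r - P N) /\
       forall t, in_ideal_of P N (t - P N) -> ~~ (mlead t < mlead r)%O.
    by apply: (H _ (P N) erefl); rewrite subrr.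
  apply: ltmwf => m IH r rm Hr.
  have [[t [Ht tr]]|H] := pselect (exists t, in_ideal_of P N (t - P N) /\
      (mlead t < mlead r)%O).
    by apply: (IH (mlead t) _ t erefl Ht); rewrite -rm.
  by exists r; split=> // t Ht; apply/negP => tr; apply: H; exists t.
have [r rP] := choice minP.
have r_neq0 N : r N != 0.
  apply/eqP => r0; apply: (noP N); have := (rP N).1.
  by rewrite r0 sub0r => /(IM _ _ (-1)); rewrite mulrNN mul1r.
have rI N : in_ideal_of P N.+1 (r N).
  by rewrite -(subrK (P N) (r N)); apply: ID => //; apply: IW (rP N).1.
(* Cancel the leading term of [r j] by a multiple of [r i]. *)
have [i [j [ij le_ij]]] := dickson (fun N => mlead (r N)).
pose mu := mnm_sub (mlead (r j)) (mlead (r i)).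
pose c := mcoeff (mlead (r j)) (r j) / mcoeff (mlead (r i)) (r i).
have lci : mcoeff (mlead (r i)) (r i) != 0 by rewrite mleadc_eq0.
have lcj : mcoeff (mlead (r j)) (r j) != 0 by rewrite mleadc_eq0.
have c_neq0 : c != 0 by rewrite mulf_neq0 // invr_neq0.
pose t := r j - (c *: mpolyX F mu) * r i.
have tI : in_ideal_of P j (t - P j).
  rewrite /t addrAC -mulNr; apply: ID; first exact: (rP j).1.
  by apply/IM/(IW i.+1).
have t_neq0 : t != 0.
  apply/eqP => t0; apply: (noP j); move: tI.
  by rewrite t0 sub0r => /(IM _ _ (-1)); rewrite mulrNN mul1r.
have muK : mnm_add mu (mlead (r i)) = mlead (r j) by rewrite submK.
have X_neq0 : mpolyX F mu != 0 by apply: mpolyX_neq0.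
have lead2 : mlead ((c *: mpolyX F mu) * r i) = mlead (r j).
  rewrite mleadM ?mleadZ ?mleadXm //.
  by rewrite mscalerI negb_or c_neq0.
have /negP := (rP j).2 t tI; apply.
rewrite lt_neqAle; apply/andP; split; last first.
  by apply: le_trans (mleadB_le _ _) _; rewrite lead2 joinxx.
apply: contra t_neq0 => /eqP tj; rewrite -mleadc_eq0 tj mcoeffB.
have -> : mcoeff (mlead (r j)) ((c *: mpolyX F mu) * r i) =
          c * mcoeff (mlead (r i)) (r i).
  by rewrite -muK -scalerAl mcoeffZ [_ * r i]mulrC mcoeffMX.
by rewrite divfK ?subrr.
Qed.

End HilbertBasis.

(** * Krull's intersection theorem *)

Section ConstantModulo.
Variables (A S : comNzRingType) (eps : {rmorphism A -> S}).
Implicit Types q : {poly A}.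

Definition constant_mod q : Prop := forall k, (0 < k)%N -> eps q`_k = 0.

Lemma constant_modD q1 q2 :
  constant_mod q1 -> constant_mod q2 -> constant_mod (q1 + q2).
Proof. by move=> H1 H2 k k_gt0; rewrite coefD rmorphD H1 // H2 // addr0. Qed.

Lemma constant_modM q1 q2 :
  constant_mod q1 -> constant_mod q2 -> constant_mod (q1 * q2).
Proof.
move=> H1 H2 k k_gt0; rewrite coefM rmorph_sum big1 //= => i _; rewrite rmorphM.
case: (posnP i) => [->|i_gt0]; last by rewrite H1 // mul0r.
by rewrite subn0 H2 // mulr0.
Qed.

End ConstantModulo.

Section Krull.
Variables (F : fieldType) (n : nat).
Implicit Types (p r : {mpoly F[n]}) (P Q : {mpoly F[n + n]}).

(** The N-th power of the maximal ideal of the origin. *)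
Definition order_ge N p : Prop := forall m, (mdeg m < N)%N -> mcoeff m p = 0.

(** The map below sends the first block of variables to x_i and the second one
to x_i t.  Its image is the Rees algebra of m = (x_1, ..., x_n), the ring of
the polynomials sum_N r_N t^N with r_N in m^N. *)
Definition rees_var (k : 'I_(n + n)) : {poly {mpoly F[n]}} :=
  match fintype.split k with
  | inl i => (mvar i)%:P
  | inr i => (mvar i)%:P * 'X
  end.

Definition rees : {mpoly F[n + n]} -> {poly {mpoly F[n]}} :=
  mmap (polyC \o @mpolyC n F) rees_var.

HB.instance Definition _ := GRing.RMorphism.on rees.

Lemma reesX k : rees (mvar k) = rees_var k.
Proof. by rewrite /rees mmapX mmap1U. Qed.

Lemma reesC c : rees (mpolyC _ c) = (mpolyC n c)%:P.
Proof. exact: mmapC. Qed.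

Lemma reesD : {morph rees : P Q / P + Q}.
Proof. exact: rmorphD. Qed.

Lemma reesM : {morph rees : P Q / P * Q}.
Proof. exact: rmorphM. Qed.

Definition in_rees N r : Prop := exists P, rees P = r%:P * 'X^N.

Lemma in_reesD N r s : in_rees N r -> in_rees N s -> in_rees N (r + s).
Proof.
move=> [P EP] [Q EQ]; exists (P + Q).
by rewrite reesD EP EQ polyCD mulrDl.
Qed.

Lemma in_reesM N M r s : in_rees N r -> in_rees M s -> in_rees (N + M) (r * s).
Proof.
move=> [P EP] [Q EQ]; exists (P * Q).
by rewrite reesM EP EQ polyCM exprD mulrACA.
Qed.

Lemma in_rees0 r : in_rees 0 r.
Proof.
elim/mpoly_ring_ind: r => [c|i|p q|p q].
- by exists (mpolyC _ c); rewrite reesC expr0 mulr1.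
- exists (mvar (lshift n i)); rewrite reesX /rees_var expr0 mulr1.
  by rewrite -[lshift n i]/(unsplit (inl i)) unsplitK.
- exact: in_reesD.
- exact: in_reesM.
Qed.

Lemma in_rees_var i : in_rees 1 (mvar i).
Proof.
exists (mvar (rshift n i)); rewrite reesX /rees_var expr1.
by rewrite -[rshift n i]/(unsplit (inr i)) unsplitK.
Qed.

Lemma mnm_split_var (m : multinom n) : (0 < mdeg m)%N ->
  exists i m', m = mnm_add (mnm1 i) m'.
Proof.
move=> m_gt0; have [i mi] : exists i, m i != 0%N.
  apply: contrapT => /forallNP H; move: m_gt0; rewrite mdegE big1 // => i _.
  by apply/eqP/negP => /negP /H.
exists i, (mnm_sub m (mnm1 i)); apply/mnmP => j.
rewrite mnmDE mnmBE mnm1E; case: eqP => [<-|_]; lia.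
Qed.

Lemma in_rees_order N r : order_ge N r -> in_rees N r.
Proof.
move=> rN; have XN m : (N <= mdeg m)%N -> in_rees N (mpolyX F m).
  elim: N {rN} m => [|N IH] m Nm; first exact: in_rees0.
  have [i [m' Em]] := mnm_split_var (leq_trans (ltn0Sn N) Nm).
  rewrite Em mpolyXD; apply: (@in_reesM 1); first exact: in_rees_var.
  by apply: IH; move: Nm; rewrite Em mdegD mdeg1.
rewrite (mpolyE r) big_seq; apply: (big_ind (in_rees N)).
- by exists 0; rewrite rmorph0 polyC0 mul0r.
- exact: in_reesD.
move=> m mr; rewrite -mul_mpolyC; apply: (@in_reesM 0); first exact: in_rees0.
apply: XN; rewrite leqNgt; apply/negP => /rN r0.
by move: mr; rewrite mcoeff_msupp r0 eqxx.
Qed.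

(** At x = 0 the elements of the Rees algebra are constant in t, since its
generators x_i t vanish there. *)
Lemma rees_coef_const Q : constant_mod (mcoeff (@mnm0 n)) (rees Q).
Proof.
elim/mpoly_ring_ind: Q => [c|i|p q|p q].
- by move=> k k_gt0; rewrite reesC coefC gtn_eqF //= mcoeff0.
- move=> k k_gt0; rewrite reesX /rees_var; case: fintype.split => j.
    by rewrite coefC gtn_eqF //= mcoeff0.
  rewrite coefMX gtn_eqF //= coefC; case: eqP => _; last exact: mcoeff0.
  by rewrite mcoeffX mnm1_eq0.
- by rewrite reesD; apply: constant_modD.
- by rewrite reesM; apply: constant_modM.
Qed.

(** Krull's intersection theorem for an ideal [I] and the maximal ideal m of
the origin.  Write f = g_N + p_N with g_N in [I] and p_N in m^N, and view
p_N t^N in the Rees algebra.  By Hilbert's basis theorem some p_N t^N is a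
combination of the p_i t^i with i < N.  The coefficient of t^N reads
p_N = sum_i c_i p_i with c_i in m, so that f = (sum_i c_i) f modulo [I]. *)
Lemma krull_intersection (I : {mpoly F[n]} -> Prop) f :
  I 0 -> (forall g h, I g -> I h -> I (g + h)) -> (forall c g, I g -> I (c * g)) ->
  (forall N, exists2 g, I g & order_ge N (f - g)) ->
  exists2 w, mcoeff (@mnm0 n) w = 1 & I (w * f).
Proof.
move=> I0 ID IM approx.
have /choice [g gP] N : exists g, I g /\ order_ge N (f - g).
  by have [g gI gN] := approx N; exists g.
have gI N := (gP N).1; have gN N := (gP N).2.
have /choice [P PE] N := in_rees_order (gN N).
have [N [Q PQ]] := hilbert_basis P.
pose c (i : 'I_N) : {mpoly F[n]} := (rees (Q i))`_(N - i).
have E : f - g N = \sum_(i < N) c i * (f - g i).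
  have := congr1 (fun T => (rees T)`_N) PQ.
  rewrite PE coefMXn ltnn subnn coefC eqxx => ->.
  rewrite raddf_sum coef_sum; apply: eq_bigr => i _.
  rewrite /= reesM PE mulrA coefMXn ltnNge (ltnW (ltn_ord i)) /=.
  by rewrite coefMC.
exists (1 - \sum_i c i).
  rewrite mcoeffB mcoeff1 eqxx raddf_sum big1 ?subr0 //= => i _.
  by rewrite rees_coef_const // subn_gt0.
rewrite (eq_bigr (fun i => c i * f - c i * g i)) in E; last first.
  by move=> i _; rewrite mulrBr.
have -> : (1 - \sum_i c i) * f = g N + (-1) * \sum_i c i * g i.
  by rewrite mulrBl mul1r mulr_suml -[X in X - _](subrK (g N)) E sumrB; ring.
apply: (ID) => //; apply: (IM); apply: (big_ind I) => // i _.
exact: IM.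
Qed.

End Krull.

(** * Polynomials vanishing to a given order *)

Notation ev z := (meval (@fun_of_matrix _ 1 _ z 0)).

Section Norm.
Variables (C : numFieldType) (n : nat).
Implicit Types z : 'rV[C]_n.

Lemma coord_le_norm z i : `|z 0 i| <= `|z|.
Proof.
apply/ler_addgt0Pl => e e_gt0.
have : ball (0 : 'rV[C]_n) (e + `|z|) z.
  by rewrite -ball_normE /ball_ /= sub0r normrN ltrDr.
case=> _ /(_ 0 i); rewrite -ball_normE /ball_ /= mxE sub0r normrN; exact: ltW.
Qed.

Lemma norm_le_coord z x : 0 <= x -> (forall i, `|z 0 i| <= x) -> `|z| <= x.
Proof.
move=> x_ge0 zx; apply/ler_addgt0Pl => e e_gt0; apply: ltW.
have : ball (0 : 'rV[C]_n) (e + x) z.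
  split=> [|j i]; first by rewrite ltr_wpDr.
  rewrite ord1 -ball_normE /ball_ /= mxE sub0r normrN.
  by apply: le_lt_trans (zx i) _; rewrite ltrDr.
by rewrite -ball_normE /ball_ /= sub0r normrN.
Qed.

End Norm.

Section Vanishing.
Variables (C : numFieldType).

Lemma poly_eq0_horner (q : {poly C}) : (forall t, q.[t] = 0) -> q = 0.
Proof.
move=> q0; apply/eqP; apply: contraT => q_neq0.
have := max_poly_roots q_neq0 (rs := [seq i%:R | i <- iota 0 (size q)]).
rewrite size_map size_iota ltnn => -> //.
  by apply/allP => _ /mapP[i _ ->]; rewrite /root q0.
by rewrite map_inj_uniq ?iota_uniq // => i j /eqP; rewrite eqr_nat => /eqP.
Qed.

Variable n : nat.
Implicit Types (p : {mpoly C[n]}) (v : 'I_n -> C).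

Let line v (w : 'I_n -> C) : {mpoly C[n]} -> {poly C} :=
  mmap polyC (fun i => (v i)%:P + (w i)%:P * 'X).

Lemma horner_line v w p t : (line v w p).[t] = meval (fun i => v i + w i * t) p.
Proof.
elim/mpoly_ring_ind: p => [c|i|p q Hp Hq|p q Hp Hq].
- by rewrite /line mmapC hornerC mevalC.
- by rewrite /line mmapX mmap1U mevalXU !hornerE.
- by rewrite /line !rmorphD /= hornerD Hp Hq.
- by rewrite /line !rmorphM /= hornerM Hp Hq.
Qed.

Lemma deriv_line v k p :
  (line v (fun i => (i == k)%:R) p)^`() = line v (fun i => (i == k)%:R) (mderiv k p).
Proof.
elim/mpoly_ring_ind: p => [c|i|p q Hp Hq|p q Hp Hq].
- by rewrite mderivC /line mmapC derivC rmorph0.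
- rewrite mderiv_var /line mmapX mmap1U derivD derivM !derivC derivX.
  by rewrite mul0r !add0r mulr1 !rmorph_nat.
- by rewrite mderivD /line !rmorphD /= derivD Hp Hq.
- by rewrite mderivM /line rmorphD !rmorphM /= derivM Hp Hq.
Qed.

(** The restriction of [p] to a line parallel to an axis has infinitely many
roots, so all partial derivatives of [p] vanish everywhere too.  By induction
on the degree, so does every coefficient. *)
Lemma mpoly_eq0_meval p : (forall v, meval v p = 0) -> p = 0.
Proof.
move=> p0; apply/mpolyP => m; rewrite mcoeff0.
move En : (mdeg m) => N; elim: N p m En p0 => [|N IH] p m En p0.
  move/eqP: En; rewrite mdeg_eq0 => /eqP ->.
  by rewrite mcoeff_mnm0.
have [k [m' Em]] : exists k m', m = mnm_add (mnm1 k) m'.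
  by apply: mnm_split_var; rewrite En.
have : mcoeff m' (mderiv k p) = 0.
  apply: IH => [|v]; first by move: En; rewrite Em mdegD mdeg1 => -[].
  have L0 : line v (fun i => (i == k)%:R) p = 0.
    by apply: poly_eq0_horner => t; rewrite horner_line.
  have := deriv_line v k p; rewrite L0 linear0 => /(congr1 (horner^~ 0)).
  rewrite horner_line horner0 => E; rewrite [RHS]E; apply: meval_eq => i.
  by rewrite mulr0 addr0.
by rewrite mcoeff_mderiv addmC -Em => /eqP; rewrite mulrn_eq0 /= => /eqP.
Qed.

End Vanishing.

Section Flat.
Variables (C : numFieldType).

Lemma poly_bounded (q : {poly C}) r : exists2 B, 0 <= B &
  forall t, `|t| <= r -> `|q.[t]| <= B.
Proof.
exists (\sum_(i < size q) `|q`_i| * `|r| ^+ i).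
  by apply: sumr_ge0 => i _; rewrite mulr_ge0 // exprn_ge0.
move=> t tr; rewrite horner_coef; apply: le_trans (ler_norm_sum _ _ _) _.
apply: ler_sum => i _; rewrite normrM normrX ler_wpM2l // lerXn2r ?nnegrE //.
by rewrite [X in _ <= X]ger0_norm // (le_trans _ tr).
Qed.

(** The constant coefficient is at most a multiple of |t| for all small t,
hence zero; divide by t and repeat.  The point t = 0 is left out because
this division gives no information there. *)
Lemma poly_flat (q : {poly C}) N K r : 0 <= K -> 0 < r ->
  (forall t, t != 0 -> `|t| <= r -> `|q.[t]| <= K * `|t| ^+ N) ->
  forall i, (i < N)%N -> q`_i = 0.
Proof.
move=> K_ge0 r_gt0; elim: N q => [//|N IH] q qK.
pose q1 := \poly_(i < size q) q`_i.+1.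
have Eq : q = q1 * 'X + (q`_0)%:P.
  apply/polyP => -[|i]; rewrite coefD coefMX coefC /= ?add0r // addr0 coef_poly.
  by case: ltnP => // ?; rewrite nth_default // ltnW.
have q0 : q`_0 = 0.
  apply/eqP; rewrite -normr_le0; apply/ler_addgt0Pl => e e_gt0; rewrite addr0.
  have [B B_ge0 q1B] := poly_bounded q1 r.
  (* q(0) is at most D |t| for 0 < |t| <= r; the [t] below makes it at most e. *)
  pose D := K * r ^+ N + B; have D_ge0 : 0 <= D.
    by rewrite addr_ge0 // mulr_ge0 // exprn_ge0 // ltW.
  have den_gt0 : 0 < e + D * r by rewrite ltr_wpDr // mulr_ge0 // ltW.
  pose t := r * e / (e + D * r); have t_gt0 : 0 < t by rewrite divr_gt0 // mulr_gt0.
  have nt : `|t| = t by rewrite gtr0_norm.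
  have tr : t <= r.
    rewrite ler_pdivrMr // mulrDr lerDl mulr_ge0 ?mulr_ge0 // ltW //.
  have -> : q`_0 = q.[t] - q1.[t] * t.
    by rewrite {2}Eq !hornerE addrC addKr.
  have nt_le : `|t| <= r by rewrite nt.
  have := qK _ (lt0r_neq0 t_gt0) nt_le; rewrite nt => qt.
  have q1t := q1B t nt_le.
  apply: le_trans (ler_normB _ _) _; rewrite normrM nt.
  apply: (@le_trans _ _ (D * t)).
    rewrite mulrDl lerD //; last by rewrite ler_wpM2r // ltW.
    apply: le_trans qt _; rewrite exprSr mulrA ler_wpM2r ?(ltW t_gt0) //.
    by rewrite ler_wpM2l // lerXn2r ?nnegrE // ltW.
  rewrite /t mulrA ler_pdivrMr // mulrDr.
  rewrite (_ : D * (r * e) = e * (D * r)); last by ring.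
  by rewrite lerDr mulr_ge0 // ltW.
case=> [_|i] //; rewrite ltnS => iN.
have -> : q`_i.+1 = q1`_i by rewrite Eq coefD coefMX coefC addr0.
apply: IH iN => t t_neq0 tr; have := qK t t_neq0 tr.
rewrite Eq q0 addr0 !hornerE normrM exprSr mulrA ler_pM2r //.
by rewrite normr_gt0.
Qed.

Variable n : nat.
Implicit Types (p : {mpoly C[n]}).

Definition flat N p : Prop := exists2 K, 0 <= K & exists2 r, 0 < r &
  forall z : 'rV[C]_n, `|z| <= r -> `|ev z p| <= K * `|z| ^+ N.

(** Restrict [p] to the lines through the origin: the coefficient of t^i of
the restriction is the value of the homogeneous component of degree i. *)
Lemma flat_order_ge N p : flat N p -> order_ge N p.
Proof.
move=> [K K_ge0 [r r_gt0 pK]] m mN.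
suff H : pihomog mdeg (mdeg m) p = 0.
  have := congr1 (mcoeff m) H; rewrite mcoeff0 pihomogE raddf_sum /=.
  have [mp|/memN_msupp_eq0 -> //] := boolP (m \in msupp p).
  rewrite big_mkcond (bigD1_seq m) ?msupp_uniq //= eqxx mcoeffZ mcoeffX eqxx mulr1.
  rewrite big1 ?addr0 // => i im; case: ifP => // _.
  by rewrite mcoeffZ mcoeffX (negPf im) mulr0.
apply: mpoly_eq0_meval => v.
pose q : {poly C} :=
  \sum_(m <- msupp p) (mcoeff m p * \prod_i v i ^+ m i) *: 'X^(mdeg m).
have qE t : q.[t] = ev (\row_i (v i * t)) p.
  rewrite mevalE horner_sum; apply: eq_bigr => m' _.
  rewrite !hornerE -mulrA; congr (_ * _).
  under [in RHS]eq_bigr do rewrite mxE exprMn.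
  by rewrite big_split /= mdegE prodrXr.
have -> : meval v (pihomog mdeg (mdeg m) p) = q`_(mdeg m).
  rewrite pihomogE raddf_sum /= coef_sum big_mkcond /=; apply: eq_bigr => m' _.
  rewrite coefZ coefXn eq_sym; case: eqP => _; last by rewrite mulr0.
  by rewrite mevalZ mevalX mulr1.
pose S := 1 + \sum_i `|v i|.
have S_gt0 : 0 < S by rewrite ltr_wpDr // sumr_ge0.
apply: (@poly_flat q N (K * S ^+ N) (r / S)) => //.
- by rewrite mulr_ge0 // exprn_ge0 // ltW.
- by rewrite divr_gt0.
move=> t t_neq0 tr; rewrite qE.
have zS : `|\row_i (v i * t)| <= S * `|t|.
  apply: norm_le_coord => [|i]; first by rewrite mulr_ge0 // ltW.
  rewrite mxE normrM ler_wpM2r // /S (bigD1 i) //= addrCA lerDl.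
  by rewrite addr_ge0 // sumr_ge0.
apply: le_trans (pK _ _) _.
  by apply: le_trans zS _; rewrite mulrC -ler_pdivlMr.
by rewrite -mulrA -exprMn ler_wpM2l // lerXn2r ?nnegrE // mulr_ge0 // ltW.
Qed.

End Flat.

(** * Jets of functions of several variables *)

Section Jets.
Variable C : numFieldType.

(** Half of the harmonic mean of the two radii.  It plays the role of their
minimum, since the order of [C] is only partial. *)
Lemma common_radius (r1 r2 : C) : 0 < r1 -> 0 < r2 ->
  exists2 r, 0 < r & r <= r1 /\ r <= r2.
Proof.
move=> r1_gt0 r2_gt0; have D_gt0 : 0 < r1 + r2 by rewrite addr_gt0.
exists (r1 * r2 / (r1 + r2)); first by rewrite divr_gt0 ?mulr_gt0.
rewrite !ler_pdivrMr //; split.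
  by rewrite ler_pM2l // lerDr ltW.
by rewrite mulrC ler_pM2l // lerDl ltW.
Qed.

Definition lipschitz_near0 n (h : 'rV[C]_n -> C) : Prop :=
  exists2 K, 0 <= K & exists2 r, 0 < r &
  forall a b, `|a| <= r -> `|b| <= r -> `|h a| <= K /\ `|h a - h b| <= K * `|a - b|.

(** The estimate is on the Lipschitz constant rather than on the values of
[h], so that it passes to first derivatives; it bounds the values by
O(|z|^(N+1)). *)
Definition remainder n N (h : 'rV[C]_n -> C) : Prop := h 0 = 0 /\
  exists2 K, 0 <= K & exists2 r, 0 < r & forall s a b,
    s <= r -> `|a| <= s -> `|b| <= s -> `|h a - h b| <= K * s ^+ N * `|a - b|.

Definition jet n N (h : 'rV[C]_n -> C) (q : {mpoly C[n]}) : Prop :=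
  remainder N (fun z => h z - ev z q).

Definition vlipschitz n k (psi : 'rV[C]_n -> 'rV[C]_k) : Prop := psi 0 = 0 /\
  exists2 K, 0 < K & exists2 r, 0 < r &
  forall a b, `|a| <= r -> `|b| <= r -> `|psi a - psi b| <= K * `|a - b|.

Section OneSpace.
Variable n : nat.
Implicit Types (g h : 'rV[C]_n -> C) (q : {mpoly C[n]}).

Lemma lipschitz_cst c : lipschitz_near0 (fun _ : 'rV[C]_n => c).
Proof.
exists `|c| => //; exists 1 => // a b _ _; split=> //.
by rewrite subrr normr0 mulr_ge0.
Qed.

Lemma lipschitz_coord i : lipschitz_near0 (fun z : 'rV[C]_n => z 0 i).
Proof.
exists 1 => //; exists 1 => // a b a1 b1; split.
  exact: le_trans (coord_le_norm a i) _.
by rewrite mul1r; apply: le_trans (coord_le_norm (a - b) i); rewrite !mxE.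
Qed.

Lemma lipschitzD g h : lipschitz_near0 g -> lipschitz_near0 h ->
  lipschitz_near0 (fun z => g z + h z).
Proof.
move=> [K1 K1_ge0 [r1 r1_gt0 gP]] [K2 K2_ge0 [r2 r2_gt0 hP]].
have [r r_gt0 [rr1 rr2]] := common_radius r1_gt0 r2_gt0.
exists (K1 + K2); first exact: addr_ge0.
exists r => // a b ar br.
have [g1 g2] := gP a b (le_trans ar rr1) (le_trans br rr1).
have [h1 h2] := hP a b (le_trans ar rr2) (le_trans br rr2).
split; first by apply: le_trans (ler_normD _ _) _; apply: lerD.
rewrite opprD addrACA mulrDl; apply: le_trans (ler_normD _ _) _; exact: lerD.
Qed.

Lemma lipschitzM g h : lipschitz_near0 g -> lipschitz_near0 h ->
  lipschitz_near0 (fun z => g z * h z).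
Proof.
move=> [K1 K1_ge0 [r1 r1_gt0 gP]] [K2 K2_ge0 [r2 r2_gt0 hP]].
have [r r_gt0 [rr1 rr2]] := common_radius r1_gt0 r2_gt0.
have KK : 0 <= K1 * K2 by apply: mulr_ge0.
exists (K1 * K2 + K1 * K2); first exact: addr_ge0.
exists r => // a b ar br.
have [g1 g2] := gP a b (le_trans ar rr1) (le_trans br rr1).
have [h1 h2] := hP a b (le_trans ar rr2) (le_trans br rr2).
have [h3 _] := hP b a (le_trans br rr2) (le_trans ar rr2).
split.
  by rewrite normrM; apply: le_trans (ler_pM _ _ g1 h1) _ => //; rewrite lerDl.
rewrite (_ : _ - _ = g a * (h a - h b) + (g a - g b) * h b); last by ring.
apply: le_trans (ler_normD _ _) _; rewrite [X in _ <= X]mulrDl !normrM lerD //.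
  by rewrite -mulrA ler_pM.
by rewrite mulrAC ler_pM.
Qed.

Lemma lipschitz_poly q : lipschitz_near0 (fun z => ev z q).
Proof.
elim/mpoly_ring_ind: q => [c|i|p q Hp Hq|p q Hp Hq].
- by under eq_fun do rewrite mevalC; apply: lipschitz_cst.
- by under eq_fun do rewrite mevalXU; apply: lipschitz_coord.
- by under eq_fun do rewrite mevalD; apply: lipschitzD.
- by under eq_fun do rewrite mevalM; apply: lipschitzM.
Qed.

Lemma remainder_lipschitz N h : remainder N h -> lipschitz_near0 h.
Proof.
move=> [h0 [K K_ge0 [r r_gt0 hP]]]; have r_ge0 := ltW r_gt0.
have KN : 0 <= K * r ^+ N by rewrite mulr_ge0 // exprn_ge0.
exists (K * r ^+ N * (1 + r)); first by rewrite mulr_ge0 // addr_ge0.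
exists r => // a b ar br; split.
  have := hP r a 0 (lexx _) ar; rewrite normr0 h0 !subr0 => /(_ r_ge0) H.
  by apply: le_trans H _; rewrite ler_wpM2l // (le_trans ar) // lerDr.
apply: le_trans (hP r a b _ ar br) _ => //.
by rewrite ler_wpM2r // ler_peMr // lerDl.
Qed.

Lemma remainder_cst0 N : remainder N (fun _ : 'rV[C]_n => 0).
Proof.
split=> //; exists 0 => //; exists 1 => // s a b _ _ _.
by rewrite subrr normr0 !mul0r.
Qed.

Lemma remainderD N g h : remainder N g -> remainder N h ->
  remainder N (fun z => g z + h z).
Proof.
move=> [g0 [K1 K1_ge0 [r1 r1_gt0 gP]]] [h0 [K2 K2_ge0 [r2 r2_gt0 hP]]].
have [r r_gt0 [rr1 rr2]] := common_radius r1_gt0 r2_gt0.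
split; first by rewrite g0 h0 addr0.
exists (K1 + K2); first exact: addr_ge0.
exists r => // s a b sr ar br.
have g1 := gP s a b (le_trans sr rr1) ar br.
have h1 := hP s a b (le_trans sr rr2) ar br.
rewrite opprD addrACA !mulrDl; apply: le_trans (ler_normD _ _) _; exact: lerD.
Qed.

Lemma remainderM N g h : remainder N g -> lipschitz_near0 h ->
  remainder N (fun z => g z * h z).
Proof.
move=> [g0 [K1 K1_ge0 [r1 r1_gt0 gP]]] [K2 K2_ge0 [r2 r2_gt0 hP]].
have [r r_gt0 [rr1 rr2]] := common_radius r1_gt0 r2_gt0.
have r_ge0 := ltW r_gt0.
have KK : 0 <= K1 * K2 by apply: mulr_ge0.
split; first by rewrite g0 mul0r.
exists (K1 * K2 * (1 + r)); first by rewrite mulr_ge0 // addr_ge0.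
exists r => // s a b sr ar br.
have s_ge0 : 0 <= s by apply: le_trans ar.
have KsN : 0 <= K1 * s ^+ N by rewrite mulr_ge0 // exprn_ge0.
have g1 := gP s a b (le_trans sr rr1) ar br.
have g2 := gP s b 0 (le_trans sr rr1) br; rewrite normr0 g0 !subr0 in g2.
have {}g2 : `|g b| <= K1 * s ^+ N * r.
  by apply: le_trans (g2 s_ge0) _; rewrite ler_wpM2l // (le_trans br).
have [h1 h2] :=
  hP a b (le_trans ar (le_trans sr rr2)) (le_trans br (le_trans sr rr2)).
rewrite (_ : _ - _ = (g a - g b) * h a + g b * (h a - h b)); last by ring.
rewrite (_ : _ * `|a - b| = K1 * s ^+ N * `|a - b| * K2 +
                           K1 * s ^+ N * r * (K2 * `|a - b|)); last by ring.
by apply: le_trans (ler_normD _ _) _; rewrite !normrM lerD // ler_pM.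
Qed.

Lemma remainder_near N g h :
  (\forall z \near (0 : 'rV[C]_n), g z = h z) -> remainder N g -> remainder N h.
Proof.
move=> gh [g0 [K K_ge0 [r r_gt0 gP]]].
have gh0 : g 0 = h 0 by apply: nbhs_singleton gh.
move/nbhs_norm0P: gh => [e /= e_gt0 gh].
have [r' r'_gt0 [rr1 rr2]] := common_radius r_gt0 e_gt0.
split; first by rewrite -gh0.
have h_gt0 : 0 < r' / 2 by rewrite divr_gt0.
have hlt : r' / 2 < r' by rewrite ltr_pdivrMr // ltr_pMr // ltr1n.
exists K => //; exists (r' / 2) => // s a b sr as_ bs.
have lte x : x <= s -> x < e.
  move=> xs; apply: le_lt_trans xs _; apply: le_lt_trans sr _.
  exact: lt_le_trans hlt _.
rewrite -!gh /= ?lte //; apply: gP => //.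
by apply: le_trans sr _; apply: le_trans (ltW hlt) _.
Qed.

Lemma remainder_bound N h : remainder N h -> exists2 K, 0 <= K & exists2 r, 0 < r &
  forall z, `|z| <= r -> `|h z| <= K * `|z| ^+ N.+1.
Proof.
move=> [h0 [K K_ge0 [r r_gt0 hP]]]; exists K => //; exists r => // z zr.
have := hP `|z| z 0 zr (lexx _); rewrite normr0 h0 !subr0 exprSr mulrA; exact.
Qed.

Lemma jet_near N g h q :
  (\forall z \near (0 : 'rV[C]_n), g z = h z) -> jet N g q -> jet N h q.
Proof.
move=> gh; apply: remainder_near; near=> z; congr (_ - _); near: z; exact: gh.
Unshelve. all: by end_near. Qed.

Lemma jet_lipschitz N h q : jet N h q -> lipschitz_near0 h.
Proof.
move=> /remainder_lipschitz /lipschitzD /(_ (lipschitz_poly q)).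
by under eq_fun do rewrite subrK.
Qed.

Lemma jet0 N h q : jet N h q -> h 0 = ev 0 q.
Proof. by case=> /eqP; rewrite subr_eq0 => /eqP. Qed.

Lemma jet_poly N q : jet N (fun z => ev z q) q.
Proof. by rewrite /jet; under eq_fun do rewrite subrr; apply: remainder_cst0. Qed.

Lemma jetD N g h p q : jet N g p -> jet N h q -> jet N (fun z => g z + h z) (p + q).
Proof.
move=> gp /(remainderD gp); congr remainder; apply/funext => z.
by rewrite mevalD opprD addrACA.
Qed.

Lemma jetM N g h p q : jet N g p -> jet N h q -> jet N (fun z => g z * h z) (p * q).
Proof.
move=> gp hq;
have := remainderD (remainderM gp (jet_lipschitz hq))
                   (remainderM hq (lipschitz_poly p)).
by congr remainder; apply/funext => z; rewrite mevalM; ring.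
Qed.

End OneSpace.

Lemma vlipschitz_coord n k (psi : 'rV[C]_n -> 'rV[C]_k) : psi 0 = 0 ->
  (forall j, lipschitz_near0 (fun z => psi z 0 j)) -> vlipschitz psi.
Proof.
move=> psi0 psiP; split=> //.
suff [K K_ge0 [r r_gt0 H]] : exists2 K, 0 <= K & exists2 r, 0 < r &
    forall j, j \in enum 'I_k -> forall a b, `|a| <= r -> `|b| <= r ->
      `|psi a 0 j - psi b 0 j| <= K * `|a - b|.
  exists (K + 1); first by rewrite ltr_wpDl.
  exists r => // a b ar br; apply: norm_le_coord => [|j].
    by rewrite mulr_ge0 // addr_ge0.
  rewrite !mxE; apply: le_trans (H j _ a b ar br) _; first by rewrite mem_enum.
  by rewrite ler_wpM2r // lerDl.
elim: (enum 'I_k) => [|j l [K1 K1_ge0 [r1 r1_gt0 IH]]].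
  by exists 0 => //; exists 1.
have [K2 K2_ge0 [r2 r2_gt0 jP]] := psiP j.
have [r r_gt0 [rr1 rr2]] := common_radius r1_gt0 r2_gt0.
exists (K1 + K2); first exact: addr_ge0.
exists r => // j'; rewrite inE => /orP[/eqP -> |/IH H] a b ar br.
  apply: le_trans (jP a b (le_trans ar rr2) (le_trans br rr2)).2 _.
  by rewrite ler_wpM2r // lerDr.
apply: le_trans (H a b (le_trans ar rr1) (le_trans br rr1)) _.
by rewrite ler_wpM2r // lerDl.
Qed.

Lemma vlipschitz_radius n k (psi : 'rV[C]_n -> 'rV[C]_k) e :
  vlipschitz psi -> 0 < e ->
  exists2 K, 0 < K & exists2 r, 0 < r & r * K <= e /\
  forall a b, `|a| <= r -> `|b| <= r -> `|psi a - psi b| <= K * `|a - b|.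
Proof.
move=> [_ [K K_gt0 [r1 r1_gt0 H]]] e_gt0; exists K => //.
have [r r_gt0 [rr1 rr2]] := common_radius r1_gt0 (divr_gt0 e_gt0 K_gt0).
exists r => //; split; first by rewrite -ler_pdivlMr.
by move=> a b ar br; apply: H; [apply: le_trans ar _|apply: le_trans br _].
Qed.

Lemma vlipschitz_near n k (psi : 'rV[C]_n -> 'rV[C]_k)
    (P : 'rV[C]_k -> Prop) :
  vlipschitz psi ->
  (\forall z \near (0 : 'rV[C]_k), P z) -> \forall z \near (0 : 'rV[C]_n), P (psi z).
Proof.
move=> psiP /nbhs_norm0P [e /= e_gt0 eP].
have [K K_gt0 [r r_gt0 [rK H]]] := vlipschitz_radius psiP e_gt0.
apply/nbhs_norm0P; exists r => //= z /= zr; apply: eP => /=.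
have := H z 0 (ltW zr); rewrite normr0 psiP.1 !subr0 => /(_ (ltW r_gt0)) Hz.
by apply: le_lt_trans Hz _; apply: lt_le_trans rK; rewrite mulrC ltr_pM2r.
Qed.

Section Composition.
Variables n k : nat.
Implicit Types (psi : 'rV[C]_n -> 'rV[C]_k) (h : 'rV[C]_k -> C).

Lemma remainder_comp N h psi :
  vlipschitz psi -> remainder N h -> remainder N (h \o psi).
Proof.
move=> psiP [h0 [K1 K1_ge0 [r1 r1_gt0 hP]]]; have psi0 := psiP.1.
split; first by rewrite /= psi0.
have [K K_gt0 [r r_gt0 [rK H]]] := vlipschitz_radius psiP r1_gt0.
have K_ge0 := ltW K_gt0.
exists (K1 * K ^+ N * K); first by rewrite !mulr_ge0 // exprn_ge0.
exists r => // s a b sr as_ bs /=.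
have s_ge0 : 0 <= s by apply: le_trans as_.
have psis x : `|x| <= s -> `|psi x| <= K * s.
  move=> xs; have := H x 0 (le_trans xs sr); rewrite normr0 psi0 !subr0.
  by move=> /(_ (ltW r_gt0)) Hx; apply: le_trans Hx _; rewrite ler_pM2l.
apply: le_trans (hP (K * s) _ _ _ (psis _ as_) (psis _ bs)) _.
  by apply: le_trans rK; rewrite mulrC ler_pM2r.
rewrite exprMn -!mulrA ler_wpM2l // ler_wpM2l ?exprn_ge0 //.
rewrite mulrCA ler_wpM2l ?exprn_ge0 //.
by apply: H; apply: le_trans sr.
Qed.

(** Up to the composition of the remainder of [h] with the Lipschitz map [psi],
[h] may be replaced by the polynomial [q]; then [q \o psi] is built from the
components of [psi] by sums and products. *)
Lemma jet_comp N h psi q (Q : k.-tuple {mpoly C[n]}) : psi 0 = 0 ->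
  jet N h q -> (forall j, jet N (fun z => psi z 0 j) (tnth Q j)) ->
  jet N (h \o psi) (comp_mpoly Q q).
Proof.
move=> psi0 hq psiQ.
have psiP : vlipschitz psi.
  by apply: vlipschitz_coord => // j; apply: jet_lipschitz (psiQ j).
suff Hq : jet N (fun z => ev (psi z) q) (comp_mpoly Q q).
  have := remainderD (remainder_comp psiP hq) Hq.
  by congr remainder; apply/funext => z /=; ring.
elim/mpoly_ring_ind: q {hq} => [c|i|p q Hp Hq|p q Hp Hq].
- rewrite comp_mpolyC; have := jet_poly N (mpolyC n c); congr jet.
  by apply/funext => z; rewrite !mevalC.
- under eq_fun do rewrite mevalXU.
  by rewrite comp_mpolyXU -tnth_nth.
- by under eq_fun do rewrite mevalD; rewrite comp_mpolyD; apply: jetD.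
- by under eq_fun do rewrite mevalM; rewrite (rmorphM (comp_mpoly Q)); apply: jetM.
Qed.

End Composition.

End Jets.

(** * Jets of convergent power series *)

Section Limits.
Local Open Scope classical_set_scope.
Variable C : numFieldType.

Lemma cvg_norm_le (T : Type) (G : set_system T) (GF : ProperFilter G)
    (u : T -> C) (l B : C) :
  u x @[x --> G] --> l -> (\forall x \near G, `|u x| <= B) -> `|l| <= B.
Proof.
move=> ul uB; apply/ler_addgt0Pl => e e_gt0.
have /cvgrPdist_le /(_ e e_gt0) lu := ul.
have [x [lx xB]] := filter_ex (filterI lu uB).
rewrite -(subrK (u x) l); apply: le_trans (ler_normD _ _) _; exact: lerD.
Qed.

End Limits.

Section MonomialLipschitz.
Variables (C : numFieldType) (n : nat).
Implicit Types (y w : 'rV[C]_n) (m : multinom n).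

(** A product of k factors of size at most s varies by at most k s^(k-1) times
the variation of its factors.  Bounding values and variation together makes
the statement stable under products. *)
Lemma monomial_lipschitz m y w s : 0 <= s -> `|y| <= s -> `|w| <= s ->
  `|monomial m y| <= s ^+ mdeg m /\
  `|monomial m y - monomial m w| <= (mdeg m)%:R * s ^+ (mdeg m).-1 * `|y - w|.
Proof.
move=> s_ge0 ys ws; set dlt := `|y - w|; have dlt_ge0 : 0 <= dlt by exact: normr_ge0.
pose P (A B : C) (k : nat) := [/\ `|A| <= s ^+ k, `|B| <= s ^+ k &
  `|A - B| <= k%:R * s ^+ k.-1 * dlt].
suff [? _ ?] : P (monomial m y) (monomial m w) (mdeg m) by [].
have P1 : P 1 1 0%N by split; rewrite ?expr0 ?normr1 // subrr normr0 !mul0r.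
have PM A B k A' B' k' : P A B k -> P A' B' k' -> P (A * A') (B * B') (k + k')%N.
  move=> [A1 B1 AB1] [A2 B2 AB2]; split; rewrite ?normrM ?exprD ?ler_pM //.
  rewrite (_ : _ - _ = A * (A' - B') + (A - B) * B'); last by ring.
  apply: le_trans (ler_normD _ _) _; rewrite !normrM natrD 2!mulrDl addrC.
  apply: lerD.
    apply: le_trans (ler_pM _ _ AB1 B2) _ => //.
    rewrite mulrAC ler_wpM2r //; case: k {A1 B1 AB1} => [|k]; first by rewrite !mul0r.
    by rewrite -mulrA -exprD addSn.
  apply: le_trans (ler_pM _ _ A1 AB2) _ => //.
  rewrite mulrA ler_wpM2r // mulrCA.
  case: k' {A2 B2 AB2} => [|k']; first by rewrite !mul0r.
  by rewrite -exprD addnS.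
rewrite /monomial mdegE.
apply: (big_ind3 P) => // i _.
have Pi : P (y 0 i) (w 0 i) 1%N.
  split; rewrite ?expr1 ?expr0 ?mul1r.
  - exact: le_trans (coord_le_norm y i) _.
  - exact: le_trans (coord_le_norm w i) _.
  - by apply: le_trans (coord_le_norm (y - w) i); rewrite !mxE.
elim: (m i) => [|k IH]; first by rewrite !expr0.
by rewrite !exprS -[k.+1]add1n; apply: PM.
Qed.

Lemma monomial_const m (x : C) : monomial m (const_mx x) = x ^+ mdeg m.
Proof. by rewrite mdegE -prodrXr; apply: eq_bigr => i _; rewrite mxE. Qed.

Lemma monomialX m y : monomial m y = ev y (mpolyX C m).
Proof. by rewrite mevalX. Qed.

Lemma msize_le (q : {mpoly C[n]}) k :
  (forall m, (k <= mdeg m)%N -> mcoeff m q = 0) -> (msize q <= k)%N.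
Proof.
move=> qk; rewrite msizeE; apply/bigmax_leqP_seq => m mq _.
by rewrite ltnNge; apply/negP => /qk q0; move: mq; rewrite mcoeff_msupp q0 eqxx.
Qed.

Lemma ev_bmultinom (q : {mpoly C[n]}) k y : (msize q <= k)%N ->
  ev y q = \sum_(m : bmultinom n k) mcoeff m q * monomial m y.
Proof.
move=> qk; rewrite {1}(mpolywE qk) raddf_sum; apply: eq_bigr => m _.
by rewrite /= mevalZ monomialX.
Qed.

Definition truncation k (c : multinom n -> C) : {mpoly C[n]} :=
  \sum_(m : bmultinom n k) c m *: mpolyX C m.

Lemma mcoeff_truncation k c m :
  mcoeff m (truncation k c) = if (mdeg m < k)%N then c m else 0.
Proof.
case: ltnP => mk; first exact: mcoeff_mpoly.
rewrite raddf_sum big1 //= => m' _; rewrite mcoeffZ mcoeffX.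
by case: eqP => [E|_]; rewrite ?mulr0 //; have := bmdeg m'; rewrite E ltnNge mk.
Qed.

Lemma msize_truncation k c : (msize (truncation k c) <= k)%N.
Proof. by apply: msize_le => m km; rewrite mcoeff_truncation ltnNge km. Qed.

End MonomialLipschitz.

Section PowerSeries.
Local Open Scope classical_set_scope.
Variables (C : numFieldType) (n : nat).
Implicit Types (g h : 'rV[C]_n -> C) (a : 'rV[C]_n).

Lemma leq_expn2 k : (k <= 2 ^ k)%N.
Proof. exact: ltnW (ltn_expl k (ltnSn 1)). Qed.

(** On the polydisc of radius rho / 2 the factor k = |m| of
[monomial_lipschitz] is absorbed by k <= 2^k, and s^(k-1) is at most s^N times
a power of rho / 2.  The bound is therefore rho^k, which the coefficients of a
series that converges at distance rho make summable, times a constant that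
does not depend on [m]. *)
Lemma monomial_remainder (m : multinom n) N (rho s : C) (y w : 'rV[C]_n) :
  (N < mdeg m)%N -> 0 < rho ->
  s <= rho / 2 -> `|y| <= s -> `|w| <= s ->
  `|monomial m y - monomial m w| <=
    (2 / rho) ^+ N.+1 * s ^+ N * `|y - w| * rho ^+ mdeg m.
Proof.
move=> Nm rho_gt0 srho ys ws; have s_ge0 : 0 <= s by apply: le_trans ys.
have rho_ge0 := ltW rho_gt0; have rho_neq0 := lt0r_neq0 rho_gt0.
apply: le_trans (monomial_lipschitz m s_ge0 ys ws).2 _.
rewrite [X in _ <= X]mulrAC; apply: ler_wpM2r => //.
rewrite -(subnKC Nm); set j := (_ - _)%N.
rewrite (_ : (N.+1 + j).-1 = N + j)%N // exprD mulrCA [X in _ <= X]mulrAC mulrC.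
rewrite ler_wpM2r ?exprn_ge0 //.
apply: (@le_trans _ _ ((2 ^+ (N.+1 + j)) * (rho / 2) ^+ j)).
  apply: ler_pM; rewrite ?exprn_ge0 ?ler0n //; last first.
    by rewrite lerXn2r ?nnegrE // divr_ge0.
  by rewrite -natrX ler_nat leq_expn2.
rewrite !exprD !expr_div_n le_eqVlt; apply/orP; left; apply/eqP.
by field; rewrite ?expf_neq0 ?rho_neq0 //= pnatr_eq0.
Qed.

(** The jet is the truncation of the series; the remainder is a limit of finite
sums of monomials of degree > N, whose Lipschitz constants add up to O(s^N). *)
Lemma holomorphic_at_jet g a N : holomorphic_at g a ->
  exists q, jet N (fun z => g (a + z)) q.
Proof.
move=> [c /nbhs0P /nbhs_norm0P [e /= e_gt0 ec]].
pose rho := e / 2; have rho_gt0 : 0 < rho by rewrite divr_gt0.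
have rho_lt : rho < e by rewrite ltr_pdivrMr // ltr_pMr // ltr1n.
have rho_ge0 := ltW rho_gt0.
have nbig : `|const_mx rho : 'rV[C]_n| < e.
  apply: le_lt_trans rho_lt; apply: norm_le_coord => // i.
  by rewrite mxE ger0_norm.
have [[M MP] _] := ec _ nbig.
have {}MP k : \sum_(m : bmultinom n k) `|c m| * rho ^+ mdeg m <= M.
  apply: le_trans (MP k); apply: ler_sum => m _.
  by rewrite addrC addKr normrM monomial_const normrX (ger0_norm rho_ge0).
have M_ge0 : 0 <= M.
  by apply: le_trans (MP 0%N); apply: sumr_ge0 => m _; rewrite mulr_ge0 // exprn_ge0.
have cvgS y : `|y| < e ->
    (\sum_(m : bmultinom n k) c m * monomial m y) @[k --> \oo] --> g (a + y).
  move=> /ec [_]; apply: cvg_trans; apply: near_eq_cvg; near=> k.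
  by apply: eq_bigr => m _; rewrite addrC addKr.
exists (truncation N.+1 c); set q := truncation _ _.
have cq m : c m - mcoeff m q = if (mdeg m < N.+1)%N then 0 else c m.
  by rewrite mcoeff_truncation; case: ifP; rewrite ?subrr ?subr0.
have Sq k y : (N.+1 <= k)%N ->
    (\sum_(m : bmultinom n k) c m * monomial m y) - ev y q =
    \sum_(m : bmultinom n k) (c m - mcoeff m q) * monomial m y.
  move=> Nk; rewrite (@ev_bmultinom _ _ q k) ?(leq_trans (msize_truncation _ _)) //.
  by rewrite -sumrB; apply: eq_bigr => m _; rewrite mulrBl.
split.
  apply/eqP; rewrite -normr_le0.
  have H : (\sum_(m : bmultinom n k) c m * monomial m 0 - ev 0 q) @[k --> \oo] -->
      g (a + 0) - ev 0 q.
    by apply: cvgB; [apply: cvgS; rewrite normr0|apply: cvg_cst].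
  apply: (cvg_norm_le _ H); near=> k.
  rewrite Sq; last by near: k; apply: nbhs_infty_ge.
  rewrite big1 ?normr0 // => m _; rewrite cq; case: ltnP => [_|Nm].
    by rewrite mul0r.
  have -> : (0 : 'rV[C]_n) = const_mx 0 by apply/rowP => i; rewrite !mxE.
  by rewrite monomial_const expr0n gtn_eqF ?mulr0 //; apply: leq_trans Nm.
pose K := (2 / rho) ^+ N.+1; have K_ge0 : 0 <= K by rewrite exprn_ge0 // divr_ge0.
exists (M * K); first exact: mulr_ge0.
exists (rho / 2) => [|s y w sr ys ws]; first by rewrite divr_gt0.
have s_ge0 : 0 <= s by apply: le_trans ys.
have lte x : x <= s -> x < e.
  move=> xs; apply: le_lt_trans xs _; apply: le_lt_trans sr _.
  by apply: le_lt_trans rho_lt; rewrite ler_pdivrMr // ler_peMr // ler1n.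
have H : ((\sum_(m : bmultinom n k) c m * monomial m y - ev y q) -
  (\sum_(m : bmultinom n k) c m * monomial m w - ev w q)) @[k --> \oo] -->
      (g (a + y) - ev y q) - (g (a + w) - ev w q).
  by apply: cvgB; apply: cvgB; try apply: cvg_cst; apply: cvgS; apply: lte.
apply: (cvg_norm_le _ H); near=> k.
rewrite !Sq; try by near: k; apply: nbhs_infty_ge.
rewrite -sumrB; apply: le_trans (ler_norm_sum _ _ _) _.
rewrite -!mulrA; apply: le_trans (ler_wpM2r _ (MP k)); last first.
  by rewrite !mulr_ge0 // exprn_ge0.
rewrite mulr_suml; apply: ler_sum => m _; rewrite -mulrBr normrM cq.
case: ltnP => Nm.
  by rewrite normr0 mul0r !mulr_ge0 // exprn_ge0.
rewrite -mulrA ler_wpM2l //.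
apply: le_trans (monomial_remainder Nm rho_gt0 sr ys ws) _.
by rewrite le_eqVlt; apply/orP; left; apply/eqP; rewrite /K; ring.
Unshelve. all: by end_near. Qed.

End PowerSeries.

Section Derivatives.
Local Open Scope classical_set_scope.
Variables (C : numFieldType) (n : nat).
Implicit Types (g h : 'rV[C]_n -> C) (a z : 'rV[C]_n) (q : {mpoly C[n]}).

Let dir (k : 'I_n) : 'rV[C]_n := delta_mx 0 k.

Lemma is_derive_coord z v i : is_derive z v (fun y : 'rV[C]_n => y 0 i) (v 0 i).
Proof.
pose coord (y : 'rV[C]_n) := y 0 i.
suff H : (fun t : C => t^-1 *: ((coord \o shift z) (t *: v) - coord z))
    @ 0^' --> v 0 i.
  by apply: DeriveDef; [apply/cvg_ex; exists (v 0 i)|apply: cvg_lim].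
apply: (cvg_trans (near_eq_cvg _) (cvg_cst (v 0 i))).
near=> t; rewrite /= /coord !mxE addrK -[RHS]/(t^-1 * (t * v 0 i)) mulKf //.
by near: t; apply: nbhs_dnbhs_neq.
Unshelve. all: by end_near. Qed.

Lemma is_derive_ev z k q :
  is_derive z (dir k) (fun y => ev y q) (ev z (mderiv k q)).
Proof.
elim/mpoly_ring_ind: q => [c|i|p q Hp Hq|p q Hp Hq].
- under eq_fun do rewrite mevalC; rewrite mderivC meval0.
  exact: is_derive_cst.
- under eq_fun do rewrite mevalXU.
  have := is_derive_coord z (dir k) i; rewrite /dir mxE eqxx /= mderiv_var.
  by rewrite rmorph_nat.
- under eq_fun do rewrite mevalD; rewrite mderivD mevalD.
  exact: (@is_deriveD _ _ _ _ _ _ _ _ _ Hp Hq).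
- under eq_fun do rewrite mevalM; rewrite mderivM mevalD !mevalM.
  have := @is_deriveM _ _ _ _ _ _ _ _ Hp Hq.
  by rewrite [_ *: _ + _]addrC -[_ *: ev z (mderiv k p)]/(_ * _) [ev z q * _]mulrC.
Qed.

Lemma is_derive_shift0 h a v d :
  is_derive 0 v (fun y => h (a + y)) d -> is_derive a v h d.
Proof.
have E : (fun t : C => t^-1 *: ((h \o shift a) (t *: v) - h a)) =
   (fun t : C => t^-1 *: (((fun y => h (a + y)) \o shift 0) (t *: v) - h (a + 0))).
  by apply/funext => t /=; rewrite !addr0 [a + _]addrC.
by case=> d1 d2; split; rewrite /derivable /derive E; [exact: d1 | exact: d2].
Qed.

Lemma remainder_is_derive0 g v : remainder 1 g -> is_derive 0 v g 0.
Proof.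
move=> gT; have [K K_ge0 [r r_gt0 gP]] := remainder_bound gT; have g0 := gT.1.
suff H : (fun t : C => t^-1 *: ((g \o shift 0) (t *: v) - g 0)) @ 0^' --> (0 : C).
  by apply: DeriveDef; [apply/cvg_ex; exists (0 : C)|apply: cvg_lim].
apply/cvgr0Pnorm_le => e e_gt0.
pose B := K * `|v| ^+ 2; have B_ge0 : 0 <= B by rewrite mulr_ge0 // exprn_ge0.
have B1 : 0 < 1 + B by rewrite ltr_wpDr.
near=> t.
have t_neq0 : t != 0 by near: t; apply: nbhs_dnbhs_neq.
rewrite /= addr0 g0 subr0 -[_ *: _]/(_ * _) normrM normfV ler_pdivrMl ?normr_gt0 //.
have tv : `|t| * `|v| <= r.
  have v1 : 0 < 1 + `|v| by rewrite ltr_wpDr.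
  apply: (@le_trans _ _ (`|t| * (1 + `|v|))); first by rewrite ler_wpM2l // lerDr.
  rewrite -ler_pdivlMr //; near: t; apply: dnbhs0_le; exact: divr_gt0.
apply: le_trans (gP _ _) _; rewrite normrZ //.
rewrite (_ : K * _ = `|t| * (`|t| * B)) ?ler_wpM2l //; last by rewrite /B; ring.
apply: (@le_trans _ _ (`|t| * (1 + B))); first by rewrite ler_wpM2l // lerDr.
rewrite -ler_pdivlMr //; near: t; apply: dnbhs0_le; exact: divr_gt0.
Unshelve. all: by end_near. Qed.

Lemma jet_is_derive h a k q : jet 1 (fun z => h (a + z)) q ->
  is_derive a (dir k) h (ev 0 (mderiv k q)).
Proof.
move=> hq; apply: is_derive_shift0.
have := @is_deriveD _ _ _ _ _ _ _ _ _ (remainder_is_derive0 (dir k) hq)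
                                      (is_derive_ev 0 k q).
by rewrite add0r; congr is_derive; apply/funext => z /=; rewrite -[LHS]/(_ + _) subrK.
Qed.

(** The difference quotients of [h] minus its jet between z and z + t e_k are
bounded by the Lipschitz constant on the ball of radius 2 |z|, and so is
their limit.  This ball has to contain a neighbourhood of z, hence z <> 0. *)
Lemma jet_derive_bound N h q k : jet N h q ->
  (\forall z \near (0 : 'rV[C]_n), derivable h z (dir k)) ->
  exists2 K, 0 <= K & exists2 r, 0 < r & forall z, z != 0 -> `|z| <= r ->
    `|'D_(dir k) h z - ev z (mderiv k q)| <= K * `|z| ^+ N.
Proof.
move=> [_ [K K_ge0 [r r_gt0 hP]]] /nbhs_norm0P [e /= e_gt0 hd].
have r4_gt0 : 0 < r / 2 by rewrite divr_gt0.
have e2_gt0 : 0 < e / 2 by rewrite divr_gt0.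
have [r' r'_gt0 [rr1 rr2]] := common_radius r4_gt0 e2_gt0.
exists (K * 2 ^+ N); first by rewrite mulr_ge0 // exprn_ge0.
exists r' => // z z_neq0 zr.
have ze : `|z| < e.
  apply: le_lt_trans zr _; apply: le_lt_trans rr2 _.
  by rewrite ltr_pdivrMr // ltr_pMr // ltr1n.
have D1 : is_derive z (dir k) h ('D_(dir k) h z) by apply/derivableP/hd.
have D2 := @is_deriveB _ _ _ _ _ _ _ _ _ D1 (is_derive_ev z k q).
have [/cvg_ex [l Hl] D2v] := D2.
have El : l = 'D_(dir k) h z - ev z (mderiv k q).
  rewrite -D2v; apply/esym; exact: (cvg_lim _ Hl).
rewrite -El; apply: (cvg_norm_le _ Hl); near=> t.
have t_neq0 : t != 0 by near: t; apply: nbhs_dnbhs_neq.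
have tz : `|t| <= `|z| by near: t; apply: dnbhs0_le; rewrite normr_gt0.
have ndir : `|dir k| <= 1.
  apply: norm_le_coord => // j; rewrite mxE eqxx /=.
  by case: eqP => _; rewrite ?normr1 ?normr0.
have tzd : `|t *: dir k| <= `|z|.
  by rewrite normrZ; apply: le_trans tz; rewrite ler_piMr.
have s1 : 2 * `|z| <= r by rewrite mulrC -ler_pdivlMr // (le_trans zr).
have s2 : `|t *: dir k + z| <= 2 * `|z|.
  apply: le_trans (ler_normD _ _) _; rewrite mulrDl mul1r; exact: lerD.
have s3 : `|z| <= 2 * `|z| by rewrite ler_peMl // ler1n.
rewrite /= -[_ *: _]/(_ * _) normrM normfV ler_pdivrMl ?normr_gt0 //.
apply: le_trans (hP _ _ _ s1 s2 s3) _.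
rewrite addrK exprMn mulrA mulrC ler_wpM2r ?mulr_ge0 ?exprn_ge0 //.
by rewrite normrZ ler_piMr.
Unshelve. all: by end_near. Qed.

End Derivatives.

(** * Reduction of the Euler equation to jets *)

Section BigO.
Variables (C : numFieldType) (n : nat).
Implicit Types (g h : 'rV[C]_n -> C) (p q : {mpoly C[n]}).

(** The origin is left out since [jet_derive_bound] says nothing there. *)
Definition bigO N h : Prop := exists2 K, 0 <= K & exists2 r, 0 < r &
  forall z : 'rV[C]_n, z != 0 -> `|z| <= r -> `|h z| <= K * `|z| ^+ N.

Lemma bigO_cst0 N : bigO N (fun _ => 0).
Proof. by exists 0 => //; exists 1 => // z _ _; rewrite normr0 mul0r. Qed.

Lemma bigOD N g h : bigO N g -> bigO N h -> bigO N (fun z => g z + h z).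
Proof.
move=> [K1 K1_ge0 [r1 r1_gt0 gP]] [K2 K2_ge0 [r2 r2_gt0 hP]].
have [r r_gt0 [rr1 rr2]] := common_radius r1_gt0 r2_gt0.
exists (K1 + K2); first exact: addr_ge0.
exists r => // z z0 zr; rewrite mulrDl; apply: le_trans (ler_normD _ _) _.
apply: lerD; first by apply: gP => //; apply: le_trans zr _.
by apply: hP => //; apply: le_trans zr _.
Qed.

Lemma bigOM N g h : bigO N g -> lipschitz_near0 h -> bigO N (fun z => g z * h z).
Proof.
move=> [K1 K1_ge0 [r1 r1_gt0 gP]] [K2 K2_ge0 [r2 r2_gt0 hP]].
have [r r_gt0 [rr1 rr2]] := common_radius r1_gt0 r2_gt0.
exists (K1 * K2); first exact: mulr_ge0.
exists r => // z z0 zr; rewrite normrM mulrAC ler_pM //.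
  by apply: gP => //; apply: le_trans zr _.
by have [] := hP z z (le_trans zr rr2) (le_trans zr rr2).
Qed.

Lemma bigO_near N g h :
  (\forall z \near (0 : 'rV[C]_n), g z = h z) -> bigO N g -> bigO N h.
Proof.
move=> /nbhs_norm0P [e /= e_gt0 gh] [K K_ge0 [r r_gt0 gP]].
have e2_gt0 : 0 < e / 2 by rewrite divr_gt0.
have [r' r'_gt0 [rr1 rr2]] := common_radius r_gt0 e2_gt0.
exists K => //; exists r' => // z z0 zr; rewrite -gh /=.
  by apply: gP => //; apply: le_trans zr _.
apply: le_lt_trans zr _; apply: le_lt_trans rr2 _.
by rewrite ltr_pdivrMr // ltr_pMr // ltr1n.
Qed.

Lemma bigO_sum (I : Type) (r : seq I) N (h : I -> 'rV[C]_n -> C) :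
  (forall i, bigO N (h i)) -> bigO N (fun z => \sum_(i <- r) h i z).
Proof.
move=> hP; elim: r => [|i r IH].
  by under eq_fun do rewrite big_nil; apply: bigO_cst0.
by under eq_fun do rewrite big_cons; apply: bigOD.
Qed.

Lemma jet_bigO N h q : jet N h q -> bigO N (fun z => h z - ev z q).
Proof.
move=> /remainder_bound [K K_ge0 [r r_gt0 hP]]; exists (K * r).
  by rewrite mulr_ge0 // ltW.
exists r => // z _ zr; apply: le_trans (hP z zr) _.
by rewrite exprS mulrA ler_wpM2r ?exprn_ge0 // ler_wpM2l.
Qed.

Lemma bigO_flat N p : ev 0 p = 0 -> bigO N (fun z => ev z p) -> flat N p.
Proof.
move=> p0 [K K_ge0 [r r_gt0 pP]]; exists K => //; exists r => // z zr.
have [->|z0] := eqVneq z 0; last exact: pP.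
by rewrite p0 normr0 mulr_ge0 // exprn_ge0.
Qed.

Lemma flat_bigO N p : flat N p -> bigO N (fun z => ev z p).
Proof.
move=> [K K_ge0 [r r_gt0 pP]]; exists K => //; exists r => // z _; exact: pP.
Qed.

Lemma bigO_expr N p : ev 0 p = 0 -> bigO N (fun z => ev z (p ^+ N)).
Proof.
move=> p0; have [K K_ge0 [r r_gt0 pP]] := lipschitz_poly p.
exists (K ^+ N); first exact: exprn_ge0.
exists r => // z _ zr; rewrite rmorphXn /= normrX -exprMn lerXn2r ?nnegrE //.
  by rewrite mulr_ge0.
have r0 : `|0 : 'rV[C]_n| <= r by rewrite normr0 ltW.
have [_] := pP z 0 zr r0.
by rewrite p0 !subr0.
Qed.

End BigO.

Section VectorJets.
Variable C : numFieldType.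

Definition vjet n k N (psi : 'rV[C]_n -> 'rV[C]_k) (Q : k.-tuple {mpoly C[n]}) :=
  psi 0 = 0 /\ forall j, jet N (fun z => psi z 0 j) (tnth Q j).

Lemma vjet_vlipschitz n k N (psi : 'rV[C]_n -> 'rV[C]_k) Q :
  vjet N psi Q -> vlipschitz psi.
Proof.
case=> psi0 H; apply: vlipschitz_coord => // j.
exact: jet_lipschitz (H j).
Qed.

Lemma vjet_comp n k l N (psi : 'rV[C]_n -> 'rV[C]_k)
    (phi : 'rV[C]_k -> 'rV[C]_l) Q P :
  vjet N psi Q -> vjet N phi P ->
  vjet N (phi \o psi) [tuple comp_mpoly Q (tnth P j) | j < l].
Proof.
move=> [psi0 psiQ] [phi0 phiP]; split=> [|j]; first by rewrite /= psi0.
by rewrite tnth_mktuple; apply: (jet_comp psi0 (phiP j)).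
Qed.

Lemma holomorphic_germ_jet n N (g : 'rV[C]_n -> C) : holomorphic_germ g ->
  exists q, jet N g q.
Proof.
move=> /nbhs_singleton /(holomorphic_at_jet N) [q hq]; exists q.
by move: hq; congr jet; apply/funext => z; rewrite add0r.
Qed.

Lemma holomorphic_map_jet n N (phi : 'rV[C]_n -> 'rV[C]_n) :
  holomorphic_map_germ phi -> phi 0 = 0 -> exists Q, vjet N phi Q.
Proof.
move=> phiH phi0; have /choice [Q HQ] j := holomorphic_germ_jet N (phiH j).
by exists [tuple Q j | j < n]; split=> // j; rewrite tnth_mktuple.
Qed.

(** A directional derivative at a point x close to the origin is read off the
jet of order 1 at x, which exists because [g] is a power series around psi(x)
and [psi] one around x. *)
Lemma comp_derivable n (g : 'rV[C]_n -> C) (psi : 'rV[C]_n -> 'rV[C]_n) k :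
  holomorphic_germ g -> holomorphic_map_germ psi -> psi 0 = 0 ->
  \forall x \near (0 : 'rV[C]_n), derivable (g \o psi) x (delta_mx 0 k).
Proof.
move=> gH psiH psi0; have [Q psiQ] := holomorphic_map_jet 0 psiH psi0.
(* [g] and the [psi_j] are power series around all points near the origin. *)
have gnear := vlipschitz_near (vjet_vlipschitz psiQ) gH.
have psinear : \forall x \near (0 : 'rV[C]_n), forall j,
    holomorphic_at (fun z => psi z 0 j) x.
  have H : \forall x \near (0 : 'rV[C]_n), forall j, j \in enum 'I_n ->
      holomorphic_at (fun z => psi z 0 j) x.
    elim: (enum 'I_n) => [|j l IH]; first by near=> x.
    have jH := psiH j; near=> x => j'; rewrite inE => /orP[/eqP -> |].
      by near: x.
    by move: j'; near: x.
  by near=> x => j; apply: (near H x) => //; rewrite mem_enum.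
near=> x.
have [q hq] : exists q, jet 1 (fun y => g (psi x + y)) q.
  by apply: holomorphic_at_jet; near: x.
have xH : forall j, holomorphic_at (fun z => psi z 0 j) x by near: x.
have /choice [R HR] j := holomorphic_at_jet 1 (xH j).
pose T := [tuple R j - mpolyC n (psi x 0 j) | j < n].
have HT j : jet 1 (fun y => (psi (x + y) - psi x) 0 j) (tnth T j).
  rewrite tnth_mktuple -mpolyCN.
  have := jetD (HR j) (jet_poly 1 (mpolyC n (- psi x 0 j))).
  by congr jet; apply/funext => y; rewrite mevalC !mxE.
have H0 : psi (x + 0) - psi x = 0 by rewrite addr0 subrr.
have HJ := jet_comp (psi := fun y => psi (x + y) - psi x) H0 hq HT.
have HJ' : jet 1 (fun y => (g \o psi) (x + y)) (comp_mpoly T q).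
  by move: HJ; congr jet; apply/funext => y /=; rewrite addrC subrK.
by have [] := jet_is_derive k HJ'.
Unshelve. all: by end_near. Qed.

End VectorJets.

Lemma exchange_chain_sum (R : comPzRingType) n (A X : 'I_n -> R) (U : R)
    (D : 'I_n -> 'I_n -> R) :
  \sum_k A k * (U * \sum_j X j * D k j) =
    \sum_j (U * \sum_k A k * D k j) * X j.
Proof.
under eq_bigr do rewrite !mulr_sumr.
rewrite exchange_big; apply: eq_bigr => j _.
by rewrite mulr_sumr mulr_suml; apply: eq_bigr => k _; ring.
Qed.

Section EulerToFormal.
Variables (C : numFieldType) (n : nat).
Implicit Types (F p q : {mpoly C[n]}) (g u : 'rV[C]_n -> C).
Implicit Types (phi psi : 'rV[C]_n -> 'rV[C]_n).

(** The ideal m * J(F), where m is the maximal ideal of the origin. *)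
Definition maximal_jacobian F p : Prop := exists2 b : 'I_n -> {mpoly C[n]},
  (forall j, ev 0 (b j) = 0) & p = \sum_j b j * mderiv j F.

Lemma ev_comp0 k (Q : n.-tuple {mpoly C[k]}) q :
  (forall j, ev 0 (tnth Q j) = 0) -> ev 0 (comp_mpoly Q q) = ev 0 q.
Proof.
move=> Q0; rewrite comp_mpoly_meval; apply: meval_eq => i.
by rewrite Q0 mxE.
Qed.

Lemma vjet0 N psi (Q : n.-tuple {mpoly C[n]}) j : vjet N psi Q -> ev 0 (tnth Q j) = 0.
Proof. by move=> [psi0 /(_ j) /jet0 <-]; rewrite psi0 mxE. Qed.

Lemma ev0_combination (A B : 'I_n -> {mpoly C[n]}) :
  (forall k, ev 0 (A k) = 0) -> ev 0 (\sum_k A k * B k) = 0.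
Proof. by move=> A0; rewrite meval_sum big1 //= => k _; rewrite mevalM A0 mul0r. Qed.

Lemma jet_sum (I : Type) (r : seq I) N (h : I -> 'rV[C]_n -> C)
    (q : I -> {mpoly C[n]}) :
  (forall i, jet N (h i) (q i)) ->
  jet N (fun z => \sum_(i <- r) h i z) (\sum_(i <- r) q i).
Proof.
move=> hP; elim: r => [|i r IH].
  rewrite big_nil; have := jet_poly N (0 : {mpoly C[n]}); congr jet.
  by apply/funext => z; rewrite big_nil meval0.
rewrite big_cons; under eq_fun do rewrite big_cons; exact: jetD.
Qed.

(** Put G = g \o psi1, theta = psi2 \o psi1 and let eta = phi1 \o phi2 be the
inverse of theta.  In the coordinates phi1 the equation reads
G = sum_k a_k dG/dx_k, and G = U * (F \o theta) with U = u \o psi1.  The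
product and chain rules turn it into

  V * (F \o theta) = sum_j B_j * (dF/dy_j \o theta),
  V = U - sum_k a_k dU/dx_k,   B_j = U * sum_k a_k dtheta_j/dx_k,

where V(0) = U(0) <> 0 and B_j(0) = 0 since the a_k vanish at 0.  Composing
with eta gives the claim.  The rules are applied to jets, i.e. to polynomials;
the only derivatives of functions that occur are those of G. *)
Lemma strongly_Euler_approx F g u phi1 psi1 phi2 psi2 (a : 'I_n -> 'rV[C]_n -> C) N :
  holomorphic_germ g -> local_coordinates phi1 psi1 ->
  (forall k, in_maximal_ideal (a k)) ->
  (\forall z \near (0 : 'rV[C]_n),
    g z = \sum_(k < n) a k z * coordinate_partial phi1 psi1 g k z) ->
  local_coordinates phi2 psi2 -> unit_germ u ->
  (\forall z \near (0 : 'rV[C]_n), g z = u z * ev (psi2 z) F) -> ev 0 F = 0 ->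
  exists w (b : 'I_n -> {mpoly C[n]}), [/\ ev 0 w != 0, (forall j, ev 0 (b j) = 0) &
    flat N (w * F - \sum_j b j * mderiv j F)].
Proof.
move=> gH [[phi1H phi10] [psi1H psi10] psiphi1 phipsi1] aH gE
  [[phi2H phi20] [psi2H psi20] psiphi2 phipsi2] [uH u0] gF F0.
have [P1 HP1] := holomorphic_map_jet N phi1H phi10.
have [P2 HP2] := holomorphic_map_jet N phi2H phi20.
have [Q1 HQ1] := holomorphic_map_jet N psi1H psi10.
have [Q2 HQ2] := holomorphic_map_jet N psi2H psi20.
pose G := g \o psi1.
pose theta := psi2 \o psi1; pose eta := phi1 \o phi2.
have [T HT] : exists T, vjet N theta T by eexists; apply: vjet_comp HQ1 HQ2.
have [E HE] : exists E, vjet N eta E by eexists; apply: vjet_comp HP2 HP1.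
have [qu Hqu] := holomorphic_germ_jet N uH.
have [U HU] : exists U, jet N (u \o psi1) U.
  by eexists; apply: jet_comp psi10 Hqu HQ1.2.
have /choice [A HA] k : exists A, jet N (a k \o psi1) A.
  have [qa Hqa] := holomorphic_germ_jet N (aH k).1.
  by eexists; apply: jet_comp psi10 Hqa HQ1.2.
have Gnear : \forall x \near (0 : 'rV[C]_n), G x = u (psi1 x) * ev (theta x) F.
  exact: vlipschitz_near (vjet_vlipschitz HQ1) gF.
pose Gq := U * comp_mpoly T F.
have HG : jet N G Gq.
  apply: (@jet_near _ _ _ (fun x => u (psi1 x) * ev (theta x) F)).
    by near=> x; apply/esym; near: x.
  apply: jetM HU _; exact: (jet_comp (psi := theta) HT.1 (jet_poly N F) HT.2).
have Gder k : \forall x \near (0 : 'rV[C]_n), derivable G x (delta_mx 0 k).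
  exact: comp_derivable.
have GE : \forall x \near (0 : 'rV[C]_n),
    G x = \sum_(k < n) a k (psi1 x) * 'D_(delta_mx 0 k) G x.
  have H := vlipschitz_near (vjet_vlipschitz HQ1) gE; near=> x.
  rewrite [G x](near H x) //; apply: eq_bigr => k _; congr (_ * _).
  by rewrite /coordinate_partial (near phipsi1 x).
have A0 k : ev 0 (A k) = 0 by rewrite -(jet0 (HA k)) /= psi10 (aH k).2.
(* [P] measures by how much the jet of [G] fails the Euler equation. *)
pose P := Gq - \sum_k A k * mderiv k Gq.
have Pflat : flat N P.
  apply: bigO_flat.
    rewrite mevalB ev0_combination //.
    rewrite mevalM ev_comp0 ?F0 ?mulr0 ?subrr // => j; exact: vjet0 HT.
  have D k : bigO N (fun x => a k (psi1 x) * 'D_(delta_mx 0 k) G x -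
                               ev x (A k * mderiv k Gq)).
    have H1 := bigOM (jet_bigO (HA k)) (lipschitz_poly (mderiv k Gq)).
    have H2 := bigOM (jet_derive_bound HG (Gder k)) (jet_lipschitz (HA k)).
    have := bigOD H1 H2; congr bigO; apply/funext => x /=; rewrite mevalM; ring.
  have D' := bigOD (bigO_sum (index_enum 'I_n) D)
     (bigOM (jet_bigO HG) (lipschitz_cst n (-1))).
  apply: bigO_near D'; near=> x.
  rewrite mevalB meval_sum sumrB -(near GE x) //; ring.
pose V := U - \sum_k A k * mderiv k U.
pose B j := U * \sum_k A k * mderiv k (tnth T j).
have PE : P = comp_mpoly T F * V - \sum_j B j * comp_mpoly T (mderiv j F).
  rewrite /P /V /B.
  have -> : \sum_k A k * mderiv k Gq = comp_mpoly T F * (\sum_k A k * mderiv k U) +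
      \sum_j (U * \sum_k A k * mderiv k (tnth T j)) * comp_mpoly T (mderiv j F).
    under eq_bigr do rewrite mderivM mderiv_comp mulrDr.
    rewrite big_split /= exchange_chain_sum mulr_sumr; congr (_ + _).
    by apply: eq_bigr => k _; ring.
  by rewrite /Gq; ring.
have etaE := vjet_vlipschitz HE.
(* [theta \o eta] is the identity, and so is its jet. *)
have Tid j : jet N (fun y => ev (eta y) (tnth T j)) (mvar j).
  have H1 := remainder_comp etaE (HT.2 j).
  have H2 : jet N (fun y => theta (eta y) 0 j) (mvar j).
    apply: (@jet_near _ _ _ (fun y => ev y (mvar j))); last exact: jet_poly.
    have phi2v := vlipschitz_near (vjet_vlipschitz HP2).
    apply: filterS2 (phi2v _ psiphi1) psiphi2 => y Ey1 Ey2.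
    by rewrite mevalXU /theta /eta /= Ey1 Ey2.
  have := remainderD H2 (remainderM H1 (lipschitz_cst n (-1))); congr remainder.
  by apply/funext => y /=; ring.
pose w := comp_mpoly E V; pose b j := comp_mpoly E (B j).
have E0 j : ev 0 (tnth E j) = 0 by apply: vjet0 HE.
have b0 j : ev 0 (b j) = 0.
  by rewrite ev_comp0 // mevalM ev0_combination ?mulr0.
exists w, b; split.
- rewrite ev_comp0 // mevalB ev0_combination //.
  by rewrite subr0 -(jet0 HU) /= psi10.
- by move=> j; apply: b0.
set R := w * F - _.
have HV q : jet N (fun y => ev (eta y) q) (comp_mpoly E q).
  exact: (jet_comp (psi := eta) HE.1 (jet_poly N q) HE.2).
have HTF q : jet N (fun y => ev (eta y) (comp_mpoly T q)) q.
  have T0 : \row_j ev (eta 0) (tnth T j) = 0 :> 'rV[C]_n.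
    by apply/rowP => j; rewrite !mxE HE.1 (vjet0 _ HT).
  have := jet_comp (psi := fun y => \row_j ev (eta y) (tnth T j))
    (Q := [tuple mvar j | j < n]) T0 (jet_poly N q).
  rewrite comp_mpoly_id; set h := _ \o _.
  have -> : h = (fun y => ev (eta y) (comp_mpoly T q)).
    apply/funext => y; rewrite /h /= comp_mpoly_meval; apply: meval_eq => j.
    by rewrite mxE.
  apply=> j; rewrite tnth_mktuple; under eq_fun do rewrite mxE; exact: Tid.
have HR : jet N (fun y => ev (eta y) P) R.
  have := jetD (jetM (HTF F) (HV V))
    (jetM (jet_sum (index_enum 'I_n) (fun j => jetM (HV (B j)) (HTF (mderiv j F))))
          (jet_poly N (-1))).
  congr jet; last by rewrite /R /w /b; ring.
  apply/funext => y; rewrite PE [in RHS]mevalB [in RHS]mevalM mevalN meval1 mulrN1.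
  rewrite (meval_sum _ _ (fun j => B j * comp_mpoly T (mderiv j F))).
  by congr (_ - _); apply: eq_bigr => j _; rewrite [in RHS]mevalM.
have R0 : ev 0 R = 0 by rewrite mevalB mevalM F0 mulr0 ev0_combination ?subrr.
apply: bigO_flat => //.
have H1 := bigOM (jet_bigO HR) (lipschitz_cst n (-1)).
have H2 : bigO N (fun y => ev (eta y) P).
  have [K K_ge0 [r r_gt0 PK]] := Pflat.
  have [L L_gt0 [r' r'_gt0 [r'L H]]] := vlipschitz_radius etaE r_gt0.
  exists (K * L ^+ N); first by rewrite mulr_ge0 // exprn_ge0 // ltW.
  exists r' => // y _ yr.
  have yL : `|eta y| <= L * `|y|.
    have := H y 0 yr; rewrite normr0 etaE.1 !subr0; apply; exact: ltW.
  apply: le_trans (PK _ _) _.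
    by apply: le_trans yL _; apply: le_trans r'L; rewrite mulrC ler_pM2r.
  rewrite -mulrA -exprMn ler_wpM2l // lerXn2r ?nnegrE // mulr_ge0 // ltW //.
have := bigOD H1 H2; congr bigO; apply/funext => y; ring.
Unshelve. all: by end_near. Qed.

(** With e = 1 - w / w(0), the sum of the e^i for i < N inverts w / w(0) up to
e^N, which is of order at least N. *)
Lemma maximal_jacobian_of_flat F w (b : 'I_n -> {mpoly C[n]}) N :
  ev 0 F = 0 -> ev 0 w != 0 -> (forall j, ev 0 (b j) = 0) ->
  flat N (w * F - \sum_j b j * mderiv j F) ->
  exists2 g, maximal_jacobian F g & order_ge N (F - g).
Proof.
move=> F0 w0 b0 Rflat; pose c := (ev 0 w)^-1.
pose e := 1 - c *: w; pose S := \sum_(i < N) e ^+ i.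
have e0 : ev 0 e = 0 by rewrite mevalB meval1 mevalZ mulVf // subrr.
exists (\sum_j (S * (c *: b j)) * mderiv j F).
  exists (fun j => S * (c *: b j)) => // j.
  by rewrite mevalM mevalZ b0 !mulr0.
have SE : S * (c *: w) = 1 - e ^+ N.
  have -> : c *: w = 1 - e by rewrite /e; ring.
  by rewrite -[RHS]opprB subrX1 -/S; ring.
apply: flat_order_ge.
have -> : F - \sum_j S * (c *: b j) * mderiv j F =
    (w * F - \sum_j b j * mderiv j F) * (S * mpolyC n c) + e ^+ N * F.
  rewrite (eq_bigr (fun j => S * mpolyC n c * (b j * mderiv j F))); last first.
    by move=> j _; rewrite -mul_mpolyC; ring.
  rewrite -mulr_sumr; move: SE; rewrite -mul_mpolyC.
  set Sum := \sum_j _ => SE.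
  have -> : e ^+ N = 1 - S * (mpolyC n c * w) by rewrite SE; ring.
  by ring.
apply: bigO_flat.
  rewrite mevalD !mevalM mevalB mevalM F0 ev0_combination //.
  by rewrite !mulr0 subrr mul0r addr0.
have H1 := bigOM (flat_bigO Rflat) (lipschitz_poly (S * mpolyC n c)).
have H2 := bigOM (bigO_expr N e0) (lipschitz_poly F).
by have := bigOD H1 H2; congr bigO; apply/funext => y; rewrite [RHS]mevalD !mevalM.
Qed.

End EulerToFormal.

(** * Rational functions are holomorphic *)

Section WeightedNorm.
Variables (C : numFieldType) (n : nat).
Implicit Types (p q : {mpoly C[n]}) (rho : C).

(** A submultiplicative norm that bounds the values of [p] on the polydisc of
radius [rho]. *)
Definition wnorm rho p : C := \sum_(m <- msupp p) `|mcoeff m p| * rho ^+ mdeg m.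

Lemma wnorm_bmultinom rho p k : (msize p <= k)%N ->
  wnorm rho p = \sum_(m : bmultinom n k) `|mcoeff m p| * rho ^+ mdeg m.
Proof.
move=> pk; rewrite /wnorm.
have E : perm_eq (msupp p)
    [seq bmnm m | m <- index_enum (bmultinom n k) & bmnm m \in msupp p].
  apply: uniq_perm; first exact: msupp_uniq.
    rewrite map_inj_uniq; last by move=> m1 m2 /eqP; rewrite -bmeqP => /eqP.
    by rewrite filter_uniq // index_enum_uniq.
  move=> m; apply/idP/mapP => [mp|[m' + ->]]; last by rewrite mem_filter => /andP[].
  exists (BMultinom (leq_trans (msize_mdeg_lt mp) pk)) => //.
  by rewrite mem_filter mem_index_enum /= mp.
rewrite (perm_big _ E) big_map big_filter big_mkcond /=.
apply: eq_bigr => m _; case: ifP => // /negbT /memN_msupp_eq0 ->.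
by rewrite normr0 mul0r.
Qed.

Lemma wnorm_ge0 rho p : 0 <= rho -> 0 <= wnorm rho p.
Proof. by move=> ?; apply: sumr_ge0 => m _; rewrite mulr_ge0 // exprn_ge0. Qed.

Lemma wnorm_le rho p q : 0 <= rho ->
  (forall m, `|mcoeff m p| <= `|mcoeff m q|) -> wnorm rho p <= wnorm rho q.
Proof.
move=> rho_ge0 pq; pose k := maxn (msize p) (msize q).
rewrite (@wnorm_bmultinom _ p k) ?leq_maxl // (@wnorm_bmultinom _ q k) ?leq_maxr //.
by apply: ler_sum => m _; rewrite ler_wpM2r // exprn_ge0.
Qed.

Lemma wnormD rho p q : 0 <= rho -> wnorm rho (p + q) <= wnorm rho p + wnorm rho q.
Proof.
move=> rho_ge0; pose k := maxn (maxn (msize p) (msize q)) (msize (p + q)).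
rewrite (@wnorm_bmultinom _ p k) ?(@wnorm_bmultinom _ q k)
        ?(@wnorm_bmultinom _ (p + q) k);
  rewrite ?leq_max ?leqnn ?orbT //.
rewrite -big_split /=; apply: ler_sum => m _.
by rewrite -mulrDl ler_wpM2r ?exprn_ge0 // mcoeffD ler_normD.
Qed.

Lemma wnorm0 rho : wnorm rho 0 = 0.
Proof. by rewrite /wnorm msupp0 big_nil. Qed.

Lemma wnormZ rho c p : wnorm rho (c *: p) = `|c| * wnorm rho p.
Proof.
pose k := maxn (msize p) (msize (c *: p)).
rewrite (@wnorm_bmultinom _ p k) ?(@wnorm_bmultinom _ (c *: p) k);
  rewrite ?leq_max ?leqnn ?orbT //.
by rewrite mulr_sumr; apply: eq_bigr => m _; rewrite mcoeffZ normrM mulrA.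
Qed.

Lemma wnormMX rho p m : wnorm rho (p * mpolyX C m) = wnorm rho p * rho ^+ mdeg m.
Proof.
rewrite /wnorm (perm_big _ (msuppMX p m)) big_map mulr_suml.
by apply: eq_bigr => m' _; rewrite mcoeffMX mdegD exprD; ring.
Qed.

Lemma wnorm_sum (I : Type) (r : seq I) (q : I -> {mpoly C[n]}) rho : 0 <= rho ->
  wnorm rho (\sum_(i <- r) q i) <= \sum_(i <- r) wnorm rho (q i).
Proof.
move=> rho_ge0; elim: r => [|i r IH]; first by rewrite !big_nil wnorm0.
by rewrite !big_cons; apply: le_trans (wnormD _ _ _) _ => //; rewrite lerD2l.
Qed.

Lemma wnormM rho p q : 0 <= rho -> wnorm rho (p * q) <= wnorm rho p * wnorm rho q.
Proof.
move=> rho_ge0; rewrite {1}(mpolyE p) mulr_suml.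
apply: le_trans (wnorm_sum _ _ _) _ => //; rewrite mulr_suml; apply: ler_sum => m _.
by rewrite -scalerAl wnormZ [_ * q]mulrC wnormMX [wnorm rho q * _]mulrC mulrA.
Qed.

Lemma wnormX rho p k : 0 <= rho -> wnorm rho (p ^+ k) <= wnorm rho p ^+ k.
Proof.
move=> rho_ge0; elim: k => [|k IH].
  by rewrite !expr0 /wnorm msupp1 big_seq1 mcoeff1 eqxx normr1 mdeg0 expr0 mulr1.
rewrite !exprS; apply: le_trans (wnormM _ _ _) _ => //.
by rewrite ler_wpM2l // wnorm_ge0.
Qed.

Lemma norm_ev_le rho p (y : 'rV[C]_n) : `|y| <= rho -> `|ev y p| <= wnorm rho p.
Proof.
move=> yrho; rewrite mevalE; apply: le_trans (ler_norm_sum _ _ _) _.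
apply: ler_sum => m _; rewrite normrM ler_wpM2l // -/(monomial m y).
by have [] := monomial_lipschitz m (le_trans (normr_ge0 y) yrho) yrho yrho.
Qed.

(** Shrinking the radius by the factor [s] gains s^N on terms of degree at
least N. *)
Lemma wnorm_shrink rho s p N : 0 <= s -> s <= 1 -> 0 <= rho -> order_ge N p ->
  wnorm (s * rho) p <= s ^+ N * wnorm rho p.
Proof.
move=> s_ge0 s1 rho_ge0 pN; rewrite /wnorm mulr_sumr big_seq [X in _ <= X]big_seq.
apply: ler_sum => m mp; rewrite exprMn mulrCA ler_wpM2r ?mulr_ge0 ?exprn_ge0 //.
rewrite ler_wiXn2l //; rewrite leqNgt; apply/negP => /pN E.
by move: mp; rewrite mcoeff_msupp E eqxx.
Qed.

Lemma order_ge_mulX p q k : ev 0 p = 0 -> order_ge k (q * p ^+ k).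
Proof.
move=> p0; case: k => [m|k]; first by rewrite ltn0.
apply/flat_order_ge/bigO_flat; first by rewrite mevalM rmorphXn /= p0 expr0n mulr0.
have := bigOM (bigO_expr k.+1 p0) (lipschitz_poly q); congr bigO.
by apply/funext => z; rewrite mevalM mulrC.
Qed.

End WeightedNorm.

(** What geometric series need in order to converge: 2^-N tends to 0 only in an
archimedean field. *)
Definition archimedean_norm (C : numFieldType) : Prop :=
  forall x : C, exists k : nat, `|x| <= k%:R.

Section RationalFunctions.
Local Open Scope classical_set_scope.
Variables (C : numFieldType) (n : nat).
Implicit Types (b w p : {mpoly C[n]}) (a y : 'rV[C]_n).

Definition translate a p : {mpoly C[n]} :=
  comp_mpoly [tuple mvar i + mpolyC n (a 0 i) | i < n] p.

Lemma ev_translate a y p : ev y (translate a p) = ev (a + y) p.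
Proof.
rewrite /translate comp_mpoly_meval; apply: meval_eq => i.
by rewrite tnth_mktuple mevalD mevalXU mevalC mxE addrC.
Qed.

(** After translation to a, write w = w(0) (1 - r) with r(0) = 0, so that
b / w is the sum of the b r^k / w(0).  As r^k has order at least k, the
coefficient of a monomial [m] in the partial sums [S N] no longer changes once
N > |m|, and this stable value is the coefficient of the power series.  On a
polydisc where r has norm at most 1/2 the norms of the [S N] are bounded, and
on the polydisc of half the radius the truncation of [S N] differs from [S N]
by O(2^-N). *)
Lemma rational_holomorphic_at b w a : archimedean_norm C ->
  ev a w != 0 -> holomorphic_at (fun z => ev z b / ev z w) a.
Proof.
move=> archi wa; pose B := translate a b; pose W := translate a w.
have [c0 c0E] : exists c0, c0 = (ev 0 W)^-1 by exists (ev 0 W)^-1.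
have W0 : ev 0 W != 0 by rewrite ev_translate addr0.
pose r := 1 - c0 *: W.
have r0 : ev 0 r = 0 by rewrite mevalB meval1 mevalZ c0E mulVf // subrr.
pose S N := c0 *: (B * \sum_(k < N) r ^+ k).
have SS N m : (mdeg m < N)%N -> mcoeff m (S N) = mcoeff m (S (mdeg m).+1).
  elim: N => // N IH; rewrite ltnS leq_eqVlt => /orP[/eqP -> //|mN].
  rewrite -IH // /S big_ord_recr /= mulrDr scalerDr mcoeffD.
  by rewrite [X in _ + X]mcoeffZ (order_ge_mulX B r0) // mulr0 addr0.
have [rho [rho_gt0 rhor]] : exists rho, 0 < rho /\ wnorm rho r <= 2^-1.
  pose D := wnorm 1 r; have D_ge0 : 0 <= D by apply: wnorm_ge0.
  have D2 : 0 < 2 * (1 + D) by rewrite mulr_gt0 // ltr_wpDr.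
  exists ((2 * (1 + D))^-1); split; first by rewrite invr_gt0.
  have s1 : (2 * (1 + D))^-1 <= 1.
    by rewrite invf_le1 // mulrDr mulr1 ler_wpDr ?ler1n ?mulr_ge0.
  rewrite -[X in wnorm X _]mulr1.
  apply: le_trans (wnorm_shrink (N := 1) _ _ _ _) _ => //.
  - by rewrite invr_ge0 ltW.
  - by have := order_ge_mulX 1 r0 (k := 1); rewrite mul1r expr1.
  rewrite expr1 -/D mulrC ler_pdivrMr // mulrA mulVf ?pnatr_eq0 // mul1r.
  by rewrite lerDr.
have rho_ge0 := ltW rho_gt0.
pose M := 2 * (`|c0| * wnorm rho B).
have half_ge0 : 0 <= 2^-1 :> C by rewrite invr_ge0.
have geo N : \sum_(k < N) (2^-1 : C) ^+ k <= 2.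
  have E : \sum_(k < N) (2^-1 : C) ^+ k = 2 - 2 * 2^-1 ^+ N.
    elim: N => [|N IH]; first by rewrite big_ord0 expr0 mulr1 subrr.
    rewrite big_ord_recr /= IH exprS; field; by rewrite ?pnatr_eq0.
  by rewrite E lerBlDr lerDl mulr_ge0 // exprn_ge0.
have SM N : wnorm rho (S N) <= M.
  rewrite /S wnormZ /M mulrCA ler_wpM2l //; apply: le_trans (wnormM _ _ _) _ => //.
  rewrite mulrC ler_wpM2r ?wnorm_ge0 //; apply: le_trans (wnorm_sum _ _ _) _ => //.
  apply: le_trans (geo N); apply: ler_sum => k _.
  apply: le_trans (wnormX _ _ _) _ => //.
  by rewrite lerXn2r ?nnegrE ?wnorm_ge0.
have M_ge0 : 0 <= M by apply: le_trans (SM 0%N); apply: wnorm_ge0.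
pose tr N := truncation N (fun m => mcoeff m (S N)).
have trE N (G : C -> multinom n -> C) :
    \sum_(m : bmultinom n N) G (mcoeff m (S (mdeg m).+1)) m =
    \sum_(m : bmultinom n N) G (mcoeff m (tr N)) m.
  apply: eq_bigr => m _; by rewrite -(SS N) ?bmdeg // mcoeff_truncation bmdeg.
exists (fun m => mcoeff m (S (mdeg m).+1)).
apply/nbhs0P/nbhs_norm0P; exists (2^-1 * rho) => /=.
  by rewrite mulr_gt0 // invr_gt0.
move=> y /= /ltW ysmall; rewrite addrC addKr.
have yrho : `|y| <= rho.
  by apply: le_trans ysmall _; rewrite ler_piMl // invf_le1 ?ltr0n // ler1n.
split.
  exists M => N; apply: le_trans (SM N).
  have /= -> := trE N (fun c m => `|c * monomial m y|).
  apply: (@le_trans _ _ (wnorm rho (tr N))).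
    rewrite (wnorm_bmultinom _ (msize_truncation N _)); apply: ler_sum => m _.
    rewrite normrM ler_wpM2l //.
    by have [] := monomial_lipschitz m rho_ge0 yrho yrho.
  apply: wnorm_le => // m; rewrite mcoeff_truncation.
  by case: ifP => //; rewrite normr0.
have ry : `|ev y r| <= 2^-1 by apply: le_trans (norm_ev_le _ yrho) _.
have r1 : 1 - ev y r != 0.
  apply/eqP => /eqP; rewrite subr_eq0 => /eqP E; move: ry; rewrite -E normr1.
  by rewrite invf_ge1 ?ltr0n // lern1.
have Wy : ev y W = ev 0 W * (1 - ev y r).
  by rewrite /r mevalB meval1 mevalZ c0E; field.
have SE N : ev y (S N) - ev (a + y) b / ev (a + y) w =
    - (c0 * ev y B * ev y r ^+ N / (1 - ev y r)).
  have := subrX1 (ev y r) N; set s := \sum_(k < N) _ => E.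
  have -> : ev y (S N) = c0 * (ev y B * s).
    rewrite /S mevalZ mevalM (meval_sum _ _ (fun k : 'I_N => r ^+ k)).
    congr (_ * (_ * _)).
    by apply: eq_bigr => k _; rewrite rmorphXn.
  rewrite -(ev_translate a y b) -(ev_translate a y w) -/B -/W Wy.
  have -> : s = (1 - ev y r ^+ N) / (1 - ev y r).
    by apply: (canRL (mulfK r1)); rewrite mulrC -[LHS]opprK -mulNr opprB -E opprB.
  by rewrite c0E; field; rewrite r1 W0.
have TS N : `|\sum_(m : bmultinom n N) mcoeff m (S (mdeg m).+1) * monomial m y -
              ev y (S N)| <= 2^-1 ^+ N * M.
  have /= -> := trE N (fun c m => c * monomial m y).
  rewrite -(ev_bmultinom y (msize_truncation N _)).
  rewrite -mevalB.
  apply: le_trans (norm_ev_le _ ysmall) _.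
  apply: le_trans (wnorm_shrink (N := N) _ _ _ _) _ => //.
  - by rewrite invf_le1 ?ltr0n // ler1n.
  - by move=> m mN; rewrite mcoeffB mcoeff_truncation mN subrr.
  rewrite ler_wpM2l ?exprn_ge0 //; apply: le_trans (SM N).
  apply: wnorm_le => // m; rewrite mcoeffB mcoeff_truncation.
  by case: ifP; rewrite ?subrr ?normr0 ?sub0r ?normrN.
have bound N : `|\sum_(m : bmultinom n N) mcoeff m (S (mdeg m).+1) * monomial m y -
     ev (a + y) b / ev (a + y) w| <= 2^-1 ^+ N * (M + M).
  rewrite -(subrK (ev y (S N)) (\sum_(m : _) _)) -addrA SE.
  apply: le_trans (ler_normD _ _) _; rewrite mulrDr lerD //.
  rewrite normrN !normrM normrX normfV ler_pdivrMr ?normr_gt0 //.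
  have r2 : 2^-1 <= `|1 - ev y r|.
    have := lerB_normD 1 (- ev y r); rewrite normr1 normrN; apply: le_trans.
    rewrite lerBrDr; apply: le_trans (lerD (lexx _) ry) _.
    by rewrite -[2^-1]div1r -splitr.
  apply: (@le_trans _ _ (`|c0| * wnorm rho B * 2^-1 ^+ N)).
    apply: ler_pM; rewrite ?exprn_ge0 ?mulr_ge0 //.
      by rewrite ler_wpM2l //; apply: norm_ev_le.
    by rewrite lerXn2r ?nnegrE.
  rewrite mulrC -mulrA ler_wpM2l ?exprn_ge0 // /M.
  apply: (@le_trans _ _ (2 * (`|c0| * wnorm rho B) * 2^-1));
    last by rewrite ler_wpM2l.
  rewrite mulrAC divff ?pnatr_eq0 // mul1r //.
apply/cvgrPdist_le => e e_gt0.
have [k kP] := archi ((M + M) / e).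
near=> N; rewrite distrC; apply: le_trans (bound N) _.
rewrite exprVn mulrC ler_pdivrMr ?exprn_gt0 // mulrC -ler_pdivrMr //.
have MM_ge0 : 0 <= (M + M) / e by rewrite divr_ge0 ?addr_ge0 // ltW.
rewrite -(ger0_norm MM_ge0); apply: le_trans kP _; rewrite -natrX ler_nat.
apply: leq_trans (leq_expn2 N); near: N; exact: nbhs_infty_ge.
Unshelve. all: by end_near. Qed.

End RationalFunctions.

(** * The algebraic Euler condition *)

Section LocalCondition.
Variables (C : numFieldType) (n : nat).
Implicit Types (F : {mpoly C[n]}) (b : 'I_n -> {mpoly C[n]}).

(** F belongs to m * J(F) in the local ring of the affine space at the origin;
the denominators are cleared by [w]. *)
Definition algebraic_Euler F : Prop := exists w b,
  [/\ ev 0 w != 0, (forall j, ev 0 (b j) = 0) & w * F = \sum_j b j * mderiv j F].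

Lemma algebraic_Euler_of_approx F :
  (forall N, exists2 g, maximal_jacobian F g & order_ge N (F - g)) ->
  algebraic_Euler F.
Proof.
move=> approx.
have [||c g|w w0 [b b0 E]] := krull_intersection _ _ _ approx.
- by exists (fun=> 0) => [j|]; rewrite ?meval0 // big1 // => j _; rewrite mul0r.
- move=> g h [b b0 ->] [c c0 ->]; exists (fun j => b j + c j) => [j|].
    by rewrite mevalD b0 c0 addr0.
  by rewrite -big_split; apply: eq_bigr => j _; rewrite mulrDl.
- move=> [b b0 ->]; exists (fun j => c * b j) => [j|].
    by rewrite mevalM b0 mulr0.
  by rewrite mulr_sumr; apply: eq_bigr => j _; rewrite mulrA.
exists w, b; split => //; rewrite (meval_eq (v2 := fun=> 0)).
  by rewrite -mcoeff_mnm0 w0 oner_neq0.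
by move=> j; rewrite mxE.
Qed.

Lemma ev_neq0_near (w : {mpoly C[n]}) : ev 0 w != 0 ->
  \forall z \near (0 : 'rV[C]_n), ev z w != 0.
Proof.
move=> w0; have [K K_ge0 [r r_gt0 wP]] := lipschitz_poly w.
have K1 : 0 < 1 + K by rewrite ltr_wpDr.
have e_gt0 : 0 < `|ev 0 w| / (1 + K) by rewrite divr_gt0 // normr_gt0.
have [s s_gt0 [sr se]] := common_radius r_gt0 e_gt0.
apply/nbhs_norm0P; exists s => //= z /= zs; apply/eqP => wz.
have r0 : `|0 : 'rV[C]_n| <= r by rewrite normr0 ltW.
have [_] := wP 0 z r0 (le_trans (ltW zs) sr).
rewrite wz subr0 sub0r normrN => H.
have : `|ev 0 w| < `|ev 0 w|.
  apply: le_lt_trans H _; apply: (@le_lt_trans _ _ ((1 + K) * `|z|)).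
    by rewrite ler_wpM2r // lerDr.
  by rewrite mulrC -ltr_pdivlMr //; apply: lt_le_trans se.
by rewrite ltxx.
Qed.

Lemma holomorphic_germ_poly (p : {mpoly C[n]}) :
  archimedean_norm C -> holomorphic_germ (fun z => ev z p).
Proof.
move=> archi; near=> a.
have := @rational_holomorphic_at C n p 1 a archi.
rewrite meval1 oner_neq0 => /(_ isT).
by congr holomorphic_at; apply/funext => z; rewrite meval1 divr1.
Unshelve. all: by end_near. Qed.

Lemma local_coordinates_id : archimedean_norm C ->
  local_coordinates (C := C) (n := n) id id.
Proof.
move=> archi; have H : holomorphic_map_germ (id : 'rV[C]_n -> 'rV[C]_n).
  move=> j; have := holomorphic_germ_poly (mvar j) archi; congr holomorphic_germ.
  by apply/funext => z; rewrite mevalXU.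
by split; [split | split | near=> z | near=> z].
Unshelve. all: by end_near. Qed.

Lemma algebraic_strongly_Euler F : archimedean_norm C ->
  ev 0 F = 0 -> algebraic_Euler F ->
  strongly_Euler_homogeneous_germ (fun z => ev z F).
Proof.
move=> archi F0 [w [b [w0 b0 E]]]; split.
  by split; first exact: holomorphic_germ_poly.
exists id, id; split; first exact: local_coordinates_id.
exists (fun k z => ev z (b k) / ev z w); split.
  move=> k; split; last by rewrite b0 mul0r.
  near=> a; apply: rational_holomorphic_at => //; near: a; exact: ev_neq0_near.
near=> z.
have wz : ev z w != 0 by near: z; exact: ev_neq0_near.
apply: (mulfI wz); rewrite -mevalM E meval_sum mulr_sumr; apply: eq_bigr => k _.
rewrite /coordinate_partial; have [_ ->] := is_derive_ev z k F.
by rewrite mevalM; field.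
Unshelve. all: by end_near. Qed.

End LocalCondition.

(** * Relations and the Euler condition in a chart *)

Section Dehomogenization.
Variables (C : numFieldType) (n : nat).
Implicit Types (f h : {mpoly C[n.+1]}) (p x : 'rV[C]_n.+1) (a z : 'rV[C]_n).
Implicit Types (i : 'I_n.+1).

Definition chart_mpoly i a : n.+1.-tuple {mpoly C[n]} :=
  [tuple if unlift i j is Some k then mvar k + mpolyC n (a 0 k) else 1 | j < n.+1].

Definition dehomogenize i a f : {mpoly C[n]} := comp_mpoly (chart_mpoly i a) f.

Lemma ev_dehomogenize i a z f :
  ev z (dehomogenize i a f) = mpoly_eval f (affine_chart i (a + z)).
Proof.
rewrite /dehomogenize comp_mpoly_meval; apply: meval_eq => j.
rewrite tnth_mktuple mxE; case: (unlift i j) => [k|]; last by rewrite meval1.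
by rewrite mevalD mevalXU mevalC mxE addrC.
Qed.

Lemma mderiv_dehomogenize i a f k :
  mderiv k (dehomogenize i a f) = dehomogenize i a (mderiv (lift i k) f).
Proof.
rewrite /dehomogenize mderiv_comp (bigD1_ord i) //= !tnth_mktuple unlift_none.
rewrite -mpolyC1 mderivC mulr0 add0r (bigD1 k) //= tnth_mktuple liftK.
rewrite mderivD mderivC addr0 mderiv_var eqxx mulr1 big1 ?addr0 // => l lk.
by rewrite tnth_mktuple liftK mderivD mderivC addr0 mderiv_var (negPf lk) mulr0.
Qed.

Lemma affine_chart_coord i p : p 0 i != 0 ->
  affine_chart i (affine_coord i p) = (p 0 i)^-1 *: p.
Proof.
move=> pi; apply/rowP => j; rewrite !mxE; case: unliftP => [k|] ->.
  by rewrite !mxE mulrC.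
by rewrite mulVf.
Qed.

Lemma homog_eval d f t x : f \is d.-homog ->
  mpoly_eval f (t *: x) = t ^+ d * mpoly_eval f x.
Proof.
move=> /dhomogP fd; rewrite /mpoly_eval !mevalE mulr_sumr !big_seq.
apply: eq_bigr => m /fd md; under eq_bigr do rewrite mxE exprMn.
by rewrite big_split /= prodrXr -mdegE md mulrCA.
Qed.

Lemma homog_mderiv d f j : f \is d.-homog -> mderiv j f \is d.-1.-homog.
Proof.
move=> /dhomogP fd; apply/dhomogP => m; rewrite mcoeff_msupp mcoeff_mderiv => mf.
have /fd /= : mnm_add m (mnm1 j) \in msupp f.
  by rewrite mcoeff_msupp; apply: contraNneq mf => ->; rewrite mul0rn.
by rewrite mdegD mdeg1 addn1 => <-.
Qed.

Lemma Euler_identity d f : f \is d.-homog -> \sum_j mvar j * mderiv j f = d%:R *: f.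
Proof.
move=> /dhomogP fd; apply/mpolyP => m; rewrite raddf_sum mcoeffZ /=.
have E j : mcoeff m (mvar j * mderiv j f) = (m j)%:R * mcoeff m f.
  case: (posnP (m j)) => [mj|mj].
    rewrite mj mul0r mulrC; apply: memN_msupp_eq0.
    rewrite (perm_mem (msuppMX _ _)); apply/mapP => -[m' _ E]; move: mj.
    by rewrite E mnmDE mnm1E eqxx.
  have Em : m = mnm_add (mnm1 j) (mnm_sub m (mnm1 j)).
    apply/mnmP => l; rewrite mnmDE mnmBE mnm1E; case: eqP => [<-|_]; lia.
  rewrite {1}Em mulrC mcoeffMX mcoeff_mderiv addmC -Em mnmBE mnm1E eqxx.
  by rewrite mulr_natl; congr (_ *+ _); lia.
rewrite (eq_bigr _ (fun j _ => E j)) -mulr_suml -natr_sum -mdegE.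
have [/fd -> //|/memN_msupp_eq0 ->] := boolP (m \in msupp f).
by rewrite !mulr0.
Qed.

Lemma homog_degree_gt0 d f p : f \is d.-homog -> f != 0 -> mpoly_eval f p = 0 ->
  (0 < d)%N.
Proof.
move=> fd f0 fp; rewrite lt0n; apply: contraNneq f0 => d0.
apply/eqP/mpoly_eq0_meval => v.
rewrite d0 in fd; have c x : mpoly_eval f x = mpoly_eval f 0.
  by have := homog_eval 0 x fd; rewrite scale0r mul1r.
have := c (\row_j v j); rewrite -(c p) fp => <-.
by apply: meval_eq => j; rewrite mxE.
Qed.

(** [q] is written in affine coordinates centered at [a]; multiplying by a
large power of x_i clears the denominators of x_j / x_i. *)
Definition homogenizable i a L (q : {mpoly C[n]}) : Prop :=
  exists W : {mpoly C[n.+1]}, forall x, x 0 i != 0 ->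
    mpoly_eval W x = x 0 i ^+ L * ev (affine_coord i x - a) q.

Lemma homogenizable_leq i a L L' q : (L <= L')%N ->
  homogenizable i a L q -> homogenizable i a L' q.
Proof.
move=> LL' [W WP]; exists (mvar i ^+ (L' - L) * W) => x xi.
rewrite /mpoly_eval mevalM rmorphXn /= mevalXU.
by rewrite -/(mpoly_eval W x) WP // mulrA -exprD subnK.
Qed.

Lemma homogenizableP i a q : exists L, homogenizable i a L q.
Proof.
elim/mpoly_ring_ind: q => [c|k|p q [L1 H1] [L2 H2]|p q [L1 [W1 H1]] [L2 [W2 H2]]].
- by exists 0%N, (mpolyC _ c) => x _; rewrite /mpoly_eval !mevalC mul1r.
- exists 1%N, (mvar (lift i k) - mpolyC _ (a 0 k) * mvar i) => x xi.
  rewrite /mpoly_eval mevalB mevalM mevalC !mevalXU !mxE; field.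
  by rewrite xi.
- exists (L1 + L2)%N.
  have [W1 {}H1] := homogenizable_leq (leq_addr L2 L1) H1.
  have [W2 {}H2] := homogenizable_leq (leq_addl L1 L2) H2.
  exists (W1 + W2) => x xi; rewrite mevalD mulrDr -H1 // -H2 //.
  by rewrite /mpoly_eval mevalD.
- exists (L1 + L2)%N, (W1 * W2) => x xi.
  rewrite /mpoly_eval !mevalM -/(mpoly_eval W1 x) -/(mpoly_eval W2 x).
  by rewrite H1 // H2 // exprD mulrACA.
Qed.

(** Restrict to x_i = 1 both Euler's formula and the relation, and eliminate
the derivative of [f] along x_i. *)
Lemma Euler_of_relation d f i p (delta : 'I_n.+1 -> {mpoly C[n.+1]}) :
  f \is d.-homog -> (0 < d)%N -> p 0 i != 0 ->
  \sum_j delta j * mderiv j f = 0 ->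
  (forall j, mpoly_eval (delta j) ((p 0 i)^-1 *: p) = ((p 0 i)^-1 *: p) 0 j) ->
  algebraic_Euler (dehomogenize i (affine_coord i p) f).
Proof.
move=> fd d_gt0 pi rel deltap; set a := affine_coord i p.
pose D := dehomogenize i a.
have DM : {morph D : x y / x * y} by apply: rmorphM.
have DB : {morph D : x y / x - y} by apply: rmorphB.
have DS (h : 'I_n.+1 -> {mpoly C[n.+1]}) : D (\sum_j h j) = \sum_j D (h j).
  exact: raddf_sum.
have D0 h : ev 0 (D h) = mpoly_eval h ((p 0 i)^-1 *: p).
  by rewrite ev_dehomogenize addr0 affine_chart_coord.
exists (d%:R *: D (delta i)).
exists (fun k => D (delta i * mvar (lift i k) - delta (lift i k))).
have pi1 : ((p 0 i)^-1 *: p) 0 i = 1 by rewrite mxE mulVf.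
split.
- by rewrite mevalZ D0 deltap pi1 mulr1 pnatr_eq0 -lt0n.
- move=> k; rewrite D0 /mpoly_eval mevalB mevalM mevalXU -!/(mpoly_eval _ _) !deltap.
  by rewrite pi1 mul1r subrr.
have E1 : d%:R *: D f = D (mderiv i f) +
    \sum_k D (mvar (lift i k)) * D (mderiv (lift i k) f).
  have <- : D (d%:R *: f) = d%:R *: D f by apply: comp_mpolyZ.
  rewrite -(Euler_identity fd) DS (bigD1_ord i) //= DM.
  under [in LHS]eq_bigr do rewrite DM.
  congr (_ + _); rewrite {1}/D /dehomogenize comp_mpolyXU -tnth_nth tnth_mktuple.
  by rewrite unlift_none mul1r.
have E2 : D (delta i) * D (mderiv i f) =
    - \sum_k D (delta (lift i k)) * D (mderiv (lift i k) f).
  have : D (\sum_j delta j * mderiv j f) = 0 by rewrite rel; apply: comp_mpoly0.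
  rewrite DS (bigD1_ord i) //= DM; under eq_bigr do rewrite DM.
  by move/eqP; rewrite addr_eq0 => /eqP.
rewrite -scalerAl scalerAr E1 mulrDr E2 addrC mulr_sumr -sumrB.
apply: eq_bigr => k _; rewrite mderiv_dehomogenize -/(D _) DB DM; ring.
Qed.

(** With W and B_k homogenizations of w and b_k, the polynomial
W f - sum_k x_i B_k df/dx_k vanishes where x_i <> 0, hence is zero.  Multiply by d
and replace d f by sum_j x_j df/dx_j: the result is a relation whose value at p
is W(p) p. *)
Lemma relation_of_Euler d f i p : f \is d.-homog -> (0 < d)%N -> p 0 i != 0 ->
  algebraic_Euler (dehomogenize i (affine_coord i p) f) ->
  exists2 delta : 'I_n.+1 -> {mpoly C[n.+1]}, \sum_j delta j * mderiv j f = 0 &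
    exists2 c, c != 0 & forall j, mpoly_eval (delta j) p = c * p 0 j.
Proof.
move=> fd d_gt0 pi; set a := affine_coord i p.
move=> [w [b [w0 b0 E]]].
have [Lw Hw] := homogenizableP i a w.
have /choice [Lb Hb] k := homogenizableP i a (b k).
pose L := (Lw + \sum_k Lb k)%N.
have [W WP] := homogenizable_leq (leq_addr (\sum_k Lb k)%N Lw) Hw.
have /choice [B BP] k : homogenizable i a L (b k).
  apply: homogenizable_leq (Hb k).
  by rewrite /L (bigD1 k) //= addnCA leq_addr.
have S0 : W * f = \sum_k (mvar i * B k) * mderiv (lift i k) f.
  apply/eqP; rewrite -subr_eq0; set S := _ - _; apply/eqP.
  have X0 : mvar i != 0 :> {mpoly C[n.+1]} by apply: mpolyX_neq0.
  apply: (mulfI X0); rewrite mulr0; apply: mpoly_eq0_meval => v.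
  pose x : 'rV[C]_n.+1 := \row_j v j.
  rewrite (meval_eq (v2 := fun_of_matrix x 0)); last by move=> j; rewrite mxE.
  rewrite mevalM mevalXU; have [->|xi] := eqVneq (x 0 i) 0; first by rewrite mul0r.
  suff -> : ev x S = 0 by rewrite mulr0.
  set y := affine_coord i x - a.
  have chartx h e : h \is e.-homog ->
      mpoly_eval h x = x 0 i ^+ e * ev y (dehomogenize i a h).
    move=> hd; rewrite ev_dehomogenize addrC subrK affine_chart_coord //.
    by rewrite -(homog_eval _ _ hd) scalerA divff // scale1r.
  rewrite mevalB mevalM -/(mpoly_eval W x) -/(mpoly_eval f x) WP //.
  rewrite (chartx _ _ fd) -/y.
  rewrite mulrACA -mevalM E !meval_sum mulr_sumr -sumrB big1 // => k _.
  rewrite mevalM mevalM mevalM mevalXU -/(mpoly_eval (B k) x) BP // -/y.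
  rewrite -/(mpoly_eval (mderiv _ _) x) (chartx _ _ (homog_mderiv _ fd)).
  rewrite mderiv_dehomogenize -{1}(prednK d_gt0) exprS; ring.
pose delta j : {mpoly C[n.+1]} := W * mvar j -
  (if unlift i j is Some k then d%:R *: (mvar i * B k) else 0).
exists delta.
  under eq_bigr do rewrite mulrBl -mulrA.
  rewrite sumrB -mulr_sumr (Euler_identity fd) -scalerAr S0 scaler_sumr.
  rewrite [X in _ - X](bigD1_ord i) //= unlift_none mul0r add0r.
  apply/eqP; rewrite subr_eq0; apply/eqP; apply: eq_bigr => k _.
  by rewrite liftK scalerAl.
have ap : affine_coord i p - a = 0 by rewrite subrr.
exists (mpoly_eval W p).
  by rewrite WP // ap mulf_neq0 // expf_neq0.
move=> j; rewrite /mpoly_eval mevalB mevalM mevalXU.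
case: (unlift i j) => [k|]; last by rewrite meval0 subr0.
by rewrite mevalZ mevalM -/(mpoly_eval (B k) p) BP // ap b0 !mulr0 subr0.
Qed.

End Dehomogenization.

(** * The rank condition *)

Lemma mxrank_row_mx_eq (F : fieldType) n m (A : 'M[F]_(n, m)) (v : 'cV[F]_n) :
  \rank A = \rank (row_mx A v) <-> exists c : 'cV[F]_m, v = A *m c.
Proof.
rewrite -(mxrank_tr (row_mx A v)) tr_row_mx -addsmxE -(mxrank_tr A).
have sub : (A^T <= A^T + v^T)%MS by apply: addsmxSl.
split=> [E|[c vE]].
  have : (v^T <= A^T)%MS.
    apply: submx_trans (addsmxSr A^T v^T) _.
    by rewrite -(mxrank_leqif_sup sub) E.
  by move=> /submxP [c /(congr1 trmx)]; rewrite trmxK trmx_mul trmxK; exists c^T.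
apply/eqP; rewrite (mxrank_leqif_sup sub) addsmx_sub submx_refl vE trmx_mul.
exact: submxMl.
Qed.

Lemma complex_archimedean (R : realType) : archimedean_norm R[i].
Proof.
move=> x; rewrite normc_def; set r := Num.sqrt _; exists (Num.bound r).
rewrite -[X in _ <= X](rmorph_nat (real_complex R)) lecR.
by apply/ltW/archi_boundP/sqrtr_ge0.
Qed.

Section RankCondition.
Variables (C : numFieldType) (n : nat) (f : {mpoly C[n.+1]}).
Variables (m : nat) (e : 'I_m -> nat) (M' : 'M[{mpoly C[n.+1]}]_(n.+1, m)).

Let evmx (p : 'rV[C]_n.+1) a b (A : 'M[{mpoly C[n.+1]}]_(a, b)) : 'M[C]_(a, b) :=
  map_mx (fun h : {mpoly C[n.+1]} => mpoly_eval h p) A.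

Lemma rank_augmentedE p : rank_at M' p = rank_at (augmented_syzygy_matrix M') p <->
  exists c, p^T = evmx p M' *m c.
Proof.
rewrite /rank_at /augmented_syzygy_matrix map_row_mx.
rewrite (_ : map_mx _ (\col_i mvar i) = p^T); first exact: mxrank_row_mx_eq.
by apply/colP => j; rewrite !mxE /mpoly_eval mevalXU.
Qed.

Lemma evmx_mul p (w : 'cV_m) : evmx p (M' *m w) = evmx p M' *m evmx p w.
Proof.
apply/colP => j; rewrite !mxE /mpoly_eval meval_sum; apply: eq_bigr => k _.
by rewrite mevalM !mxE.
Qed.

(** The columns of M' are homogeneous, so p may be rescaled, each column
absorbing a power of the scalar [t]. *)
Lemma rank_relation p t : syzygy_matrix f e M' -> t != 0 ->
  rank_at M' p = rank_at (augmented_syzygy_matrix M') p ->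
  exists2 delta : 'I_n.+1 -> {mpoly C[n.+1]}, \sum_j delta j * mderiv j f = 0 &
    forall j, mpoly_eval (delta j) (t *: p) = (t *: p) 0 j.
Proof.
move=> M'_syz t0 /rank_augmentedE [c Ec]; have [M'h M'r _] := M'_syz.
pose w : 'cV[{mpoly C[n.+1]}]_m := \col_k mpolyC _ (t * t ^- e k * c k 0).
exists (fun j => (M' *m w) j 0).
  under eq_bigr do rewrite mxE mulr_suml.
  rewrite exchange_big big1 //= => k _.
  have := M'r k; rewrite /is_relation => E.
  transitivity (w k 0 * \sum_j (col k M') j 0 * mderiv j f); last by rewrite E mulr0.
  by rewrite mulr_sumr; apply: eq_bigr => j _; rewrite !mxE; ring.
move=> j; have := congr1 (fun A : 'cV_n.+1 => A j 0) Ec; rewrite !mxE => ->.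
rewrite mulr_sumr /mpoly_eval meval_sum; apply: eq_bigr => k _.
rewrite mevalM !mxE mevalC -/(mpoly_eval (M' j k) _) (homog_eval _ _ (M'h j k)).
by field; rewrite expf_neq0.
Qed.

Lemma relation_rank p c (delta : 'I_n.+1 -> {mpoly C[n.+1]}) :
  syzygy_matrix f e M' -> c != 0 -> \sum_j delta j * mderiv j f = 0 ->
  (forall j, mpoly_eval (delta j) p = c * p 0 j) ->
  rank_at M' p = rank_at (augmented_syzygy_matrix M') p.
Proof.
move=> M'_syz c0 rel deltap; apply/rank_augmentedE.
have [_ _ /(_ (\col_j delta j))] := M'_syz.
case=> [|w Ew]; first by rewrite /is_relation; under eq_bigr do rewrite mxE.
exists (c^-1 *: evmx p w); rewrite -scalemxAr -evmx_mul -Ew.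
by apply/colP => j; rewrite !mxE deltap mulKf.
Qed.

End RankCondition.

Lemma rV_neq0_coord (F : fieldType) n (p : 'rV[F]_n) : p != 0 -> exists i, p 0 i != 0.
Proof.
move=> p0; apply: contrapT => /forallNP H; move/eqP: p0; apply.
by apply/rowP => i; rewrite mxE; apply/eqP/negPn/negP => /H.
Qed.

Theorem theorem1p3 (R : realType) (n d : nat) (f : {mpoly R[i][n.+1]})
    (f_homog : f \is d.-homog)
    (f_reduced : reduced_equation f)
    (m : nat) (e : 'I_m -> nat) (M' : 'M[{mpoly R[i][n.+1]}]_(n.+1, m))
    (M'_syzygy : syzygy_matrix f e M')
    (p : 'rV[R[i]]_n.+1) (p_neq0 : p != 0) (p_in_D : mpoly_eval f p = 0) :
  strongly_Euler_homogeneous_at f p <->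
  rank_at M' p = rank_at (augmented_syzygy_matrix M') p.
Proof.
have d_gt0 := homog_degree_gt0 f_homog f_reduced.1 p_in_D.
have F0 i : p 0 i != 0 -> ev 0 (dehomogenize i (affine_coord i p) f) = 0.
  move=> pi; rewrite ev_dehomogenize addr0 affine_chart_coord //.
  by rewrite (homog_eval _ _ f_homog) p_in_D mulr0.
split.
- move=> [g [[gm [phi1 [psi1 [crd1 [a [am gE]]]]]]]].
  move=> [i [phi2 [psi2 [pi crd2 [u [u_unit gF]]]]]].
  have alg : algebraic_Euler (dehomogenize i (affine_coord i p) f).
    apply: algebraic_Euler_of_approx => N.
    have [|w [b [w0 b0 Rflat]]] :=
      strongly_Euler_approx N gm.1 crd1 am gE crd2 u_unit _ (F0 i pi).
      by apply: filterS gF => z ->; rewrite ev_dehomogenize.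
    exact: maximal_jacobian_of_flat (F0 i pi) w0 b0 Rflat.
  have [delta rel [c c0 deltap]] := relation_of_Euler f_homog d_gt0 pi alg.
  exact: relation_rank M'_syzygy c0 rel deltap.
- move=> rk; have [i pi] := rV_neq0_coord p_neq0.
  have [|delta rel deltap] := rank_relation M'_syzygy (t := (p 0 i)^-1) _ rk.
    by rewrite invr_eq0.
  have alg := Euler_of_relation f_homog d_gt0 pi rel deltap.
  exists (fun z => ev z (dehomogenize i (affine_coord i p) f)); split.
    exact: algebraic_strongly_Euler (@complex_archimedean R) (F0 i pi) alg.
  exists i, id, id; split=> //.
    exact: local_coordinates_id (@complex_archimedean R).
  exists (fun z => ev z (1 : {mpoly R[i][n]})); split.
    split; first exact: holomorphic_germ_poly (@complex_archimedean R).
    by rewrite meval1 oner_neq0.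
  by near=> z; rewrite meval1 mul1r ev_dehomogenize.
Unshelve. all: by end_near. Qed.
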